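(* Let $A$ and $B$ be Young functions for which there is $c>0$ with $B(t)\le A(ct)$ for all $t>0$. Assume that $A$ is finite-valued, that $$\int_0^\infty B\Bigl(\kappa\log\bigl(1+\tfrac1t\bigr)\Bigr)\,dt<\infty\quad\text{for some }\kappa>0,$$ and that there exists $K>0$ such that $$\int_0^t\frac{B(s)}{s^2}\,ds\le\frac{A(Kt)}{t}\qquad\text{and}\qquad\int_0^t\frac{\tilde A(s)}{s^2}\,ds\le\frac{\tilde B(Kt)}{t}\quad\text{for all } t>0.$$ Let $(T_n)_{n\ge1}$ be a nondecreasing sequence of positive numbers with $T_n\to\infty$ and $T_n=o(n^{1/34})$ as $n\to\infty$, and let $\chi_n=\chi_{(-T_n,T_n)}$. Suppose that $f\in E^A(\mathbb{R})$. Then, given $\varepsilon>0$, there exist a smooth compactly supported function $h$ on $\mathbb{R}$ and $n_0\in\mathbb{N}$ such that $$\int_{\mathbb{R}}B\bigl(|\chi_nS_nh-f|\bigr)<\varepsilon\quad\text{for all } n\ge n_0.$$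
   Context: Hermite sums. For $k=0,1,\dots$ the Hermite function is $h_k(x)=(-1)^k\gamma_k e^{x^2/2}\frac{d^k}{dx^k}e^{-x^2}$, $x\in\mathbb{R}$, with $\gamma_k=\pi^{-1/4}2^{-k/2}(k!)^{-1/2}$. For a suitable function $f$ on $\mathbb{R}$, $S_nf=\sum_{k=0}^n c_kh_k$ with $c_k=\int_{\mathbb{R}}fh_k$. A Young function is a function $A:[0,\infty)\to[0,\infty]$ that is left-continuous, convex, satisfies $A(0)=0$ and is not constant in $(0,\infty)$. Its conjugate is $\tilde A(t)=\sup\{\tau t-A(\tau):\tau\ge0\}$. Further, $E^A(\mathbb{R})=\{f:\mathbb{R}\to\mathbb{R}\text{ measurable}:\int_{\mathbb{R}}A(c|f|)<\infty\text{ for all }c>0\}$. *)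

(* Defs.v *)
From HB Require Import structures.
From mathcomp Require Import all_boot all_order all_algebra.
From mathcomp Require Import all_classical all_reals all_analysis.
Set Implicit Arguments.
Unset Strict Implicit.
Unset Printing Implicit Defensive.
Import Order.TTheory GRing.Theory Num.Theory.
Import numFieldNormedType.Exports.
Local Open Scope classical_set_scope.
Local Open Scope ring_scope.

(* Integrals are taken for [completed_lebesgue_measure], and "measurable" means
   Lebesgue (not just Borel) measurable: the domain below is the measurable
   type, with carrier R, on which [completed_lebesgue_measure] lives. *)
Definition lebesgue_measurable (R : realType) (f : R -> R) : Prop :=
  measurable_fun
    [set: caratheodory_type ((wlength (idfun : R -> R))^*)%mu] f.

(* A Young function is a map from [0, +oo[ to [0, +oo]; it is encoded as a map
   on R whose values at negative arguments are irrelevant. *)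
Definition young_function (R : realType) (A : R -> \bar R) : Prop :=
  [/\ A 0 = 0%E,
      (forall t : R, 0 <= t -> (0 <= A t)%E),
      (forall t : R, 0 < t -> A x @[x --> t^'-] --> A t),
      (forall s t l : R, 0 <= s -> 0 <= t -> 0 <= l <= 1 ->
         (A (l * s + (1 - l) * t)%R <= l%:E * A s + (1 - l)%:E * A t)%E)
    & ~ (exists k : \bar R, forall t : R, 0 < t -> A t = k)].

Definition conjugate (R : realType) (A : R -> \bar R) (t : R) : \bar R :=
  ereal_sup [set ((tau * t)%:E - A tau)%E | tau in `[0, +oo[].

Definition orlicz_E (R : realType) (A : R -> \bar R) (f : R -> R) : Prop :=
  lebesgue_measurable f /\
  forall c : R, 0 < c ->
    (\int[completed_lebesgue_measure]_x A (c * `|f x|)%R < +oo)%E.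

Definition hermite_gamma (R : realType) (k : nat) : R :=
  pi `^ (- 4^-1) * 2 `^ (- (k%:R / 2)) * k`!%:R `^ (- 2^-1).

Definition hermite_fun (R : realType) (k : nat) (x : R) : R :=
  (-1) ^+ k * hermite_gamma R k * expR (x ^+ 2 / 2)
  * derive1n k (fun y : R => expR (- y ^+ 2)) x.

Definition hermite_coef (R : realType) (f : R -> R) (k : nat) : R :=
  \int[completed_lebesgue_measure]_x (f x * hermite_fun k x).

Definition hermite_sum (R : realType) (n : nat) (f : R -> R) (x : R) : R :=
  \sum_(k < n.+1) hermite_coef f k * hermite_fun k x.

Definition smooth (R : realType) (h : R -> R) : Prop :=
  forall (n : nat) (x : R), derivable (derive1n n h) x 1.

Definition compactly_supported (R : realType) (h : R -> R) : Prop :=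
  compact (closure [set x | h x != 0]).

(* Main.v *)
Require Import Defs.
From HB Require Import structures.
From mathcomp Require Import all_boot all_order all_algebra.
From mathcomp Require Import all_classical all_reals all_analysis.
From mathcomp Require Import measurable_realfun zify ring lra.
Set Implicit Arguments.
Unset Strict Implicit.
Unset Printing Implicit Defensive.
Import Order.TTheory GRing.Theory Num.Theory.
Import numFieldNormedType.Exports.
Local Open Scope classical_set_scope.
Local Open Scope ring_scope.

(** Two facts combine: compactly supported smooth functions are dense in [E^A]
    for the modular [int A(c |.|)], and for such a function [h] the Hermite sums
    converge to [h] uniformly on [(-T_n, T_n)], at a rate that beats the length
    of that interval.  Since [B(t) <= A(ct)], both [f - h] and
    [chi_n S_n h - h] then have small modular for [B], which gives the claim.

    Convergence.  Fix [x] and set [g = h - (h x / h_0 x) h_0], so that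
    [g x = 0].  As [S_n h_0 = h_0], one has [S_n h x - h x = S_n g x].  Write
    [g y = (y - x) q y] with [q] smooth.  Multiplication by [y] acts on the
    Hermite coefficients by the three-term recurrence, hence the sum telescopes
    (the Christoffel-Darboux identity, [hermite_sum_telescope]) to
    [sqrt((n + 1) / 2) (c_{n+1}(q) h_n(x) - c_n(q) h_{n+1}(x))].  The values
    [h_n(x)] are at most 2 when [x ^ 2 <= n], by monotonicity of an energy of
    the Hermite equation ([hermite_fun_le2]).  Two integrations by parts give
    [c_n(q) = O(1 / n)] ([hermite_coef_smooth_le]), where the constant is a
    weighted sup norm of the first two derivatives of [q] and is controlled by
    a power of [1 + |x|] ([quotient_weight_le]).  Altogether
    [|S_n h x - h x| <= K (1 + |x|) ^ 7 / sqrt n] for [x ^ 2 <= n]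
    ([hermite_sum_uniform]); with [|x| < T_n <= n ^ (1/34)] the right-hand side
    is [O(T_n ^ (-10))], and near 0 the function [B] is at most linear, so the
    integral over [(-T_n, T_n)] tends to 0.

    Density.  The functions that test functions approximate in modular form a
    vector space closed under dominated pointwise limits
    ([approximable_dominated_limit]).  It contains the indicators of bounded
    intervals, which are limits of the explicit smooth functions
    [w / (w + 1/n)] with [w > 0] exactly on the interval; hence, by a Dynkin
    argument, those of bounded Borel and Lebesgue sets, and finally all of
    [E^A] by approximation with simple functions ([approximable_orlicz]). *)

(** * Integration over the line *)

Notation completedR R := (caratheodory_type ((wlength (idfun : R -> R))^*)%mu).

Lemma measurable_caratheodory (R : realType) d (T : measurableType d) (f : R -> T) :
  measurable_fun [set: R] f -> measurable_fun [set: completedR R] f.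
Proof.
move=> mf _ B mB; have := mf measurableT _ mB.
exact: sub_caratheodory.
Qed.

(** Lebesgue measure is the image of its completion under the identity. *)
Lemma ge0_integral_completed (R : realType) (D : set R) (f : R -> \bar R) :
  measurable D -> measurable_fun D f -> (forall x, D x -> (0 <= f x)%E) ->
  (\int[completed_lebesgue_measure]_(x in D) f x =
   \int[lebesgue_measure]_(x in D) f x)%E.
Proof.
move=> mD mf f0.
have mid : measurable_fun [set: completedR R] (idfun : _ -> measurableTypeR R).
  apply: measurable_caratheodory; exact: measurable_id.
have := @ge0_integral_pushforward _ _ _ (measurableTypeR R) _ _ mid
  completed_lebesgue_measure D f mD mf.
move=> /= <-; last by move=> x /set_mem; exact: f0.
by apply: eq_measure_integral.
Qed.

Lemma integral_completed (R : realType) (D : set R) (f : R -> \bar R) :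
  measurable D -> measurable_fun D f ->
  (\int[completed_lebesgue_measure]_(x in D) f x =
   \int[lebesgue_measure]_(x in D) f x)%E.
Proof.
move=> mD mf; rewrite [LHS]integralE [RHS]integralE.
rewrite !ge0_integral_completed//.
- exact: measurable_funeneg.
- exact: measurable_funepos.
Qed.

Section line.
Context {R : realType}.
Notation mu := (@lebesgue_measure R).
Local Notation W := (@oneDsqr R).

Lemma oneDsqr_pos (x : R) : 0 < W x.
Proof. by rewrite (lt_le_trans ltr01)// oneDsqr_ge1. Qed.

Lemma integralT_oneDsqr : (\int[mu]_x ((W x)^-1)%:E = (pi : R)%:E)%E.
Proof.
rewrite (@ge0_symfun_integralT _ (fun x => (W x)^-1)).
- rewrite (_ : [set x | _] = `[0, +oo[%classic); last first.
    by apply/seteqP; split => x/=; rewrite in_itv/= andbT.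
  by rewrite integral0y_oneDsqr -EFinM mulrCA divff// mulr1.
- by move=> x; rewrite invr_ge0 ltW// oneDsqr_pos.
- exact: continuous_oneDsqrV.
- by move=> x/=; rewrite /oneDsqr sqrrN.
Qed.

Lemma integrable_oneDsqrV : mu.-integrable setT (EFin \o (fun x => (W x)^-1)).
Proof.
have mW : measurable_fun setT (fun x => (W x)^-1).
  by apply: continuous_measurable_fun; exact: continuous_oneDsqrV.
apply/integrableP; split; first exact/measurable_EFinP.
under eq_integral => x _ do
  rewrite /= ger0_norm ?(invr_ge0, ltW (oneDsqr_pos x))//.
by rewrite integralT_oneDsqr ltry.
Qed.

(** Quadratic decay: enough both for integrability and for vanishing boundary
    terms. *)
Definition decays (f : R -> R) := exists C : R, forall x, `|f x| * W x <= C.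

Lemma decaysP (f : R -> R) :
  decays f -> exists2 C : R, 0 <= C & forall x, `|f x| <= C / W x.
Proof.
move=> [C fC]; exists C.
  by apply: le_trans (fC 0); rewrite mulr_ge0// ltW// oneDsqr_pos.
by move=> x; rewrite ler_pdivlMr ?oneDsqr_pos.
Qed.

Lemma decays_integrable (f : R -> R) :
  measurable_fun setT f -> decays f -> mu.-integrable setT (EFin \o f).
Proof.
move=> mf /decaysP [C C0 fC].
have := integrableZl measurableT C integrable_oneDsqrV.
apply: le_integrable => //; first exact/measurable_EFinP.
move=> x _ /=; rewrite lee_fin [leRHS]ger0_norm//.
by rewrite mulr_ge0// invr_ge0 ltW// oneDsqr_pos.
Qed.

Lemma decays_cvg0 (f : R -> R) (s : nat -> R) : decays f ->
  (forall n, n%:R <= `|s n|) -> f (s n) @[n --> \oo] --> (0 : R).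
Proof.
move=> /decaysP[C C0 fC] sn.
apply: norm_cvg0.
apply: (@squeeze_cvgr _ _ _ _ (fun=> 0) (fun n => C * (n.+1%:R^-1))).
- near=> n; rewrite normr_ge0/= (le_trans (fC _))// ler_wpM2l//.
  rewrite lef_pV2 ?posrE ?oneDsqr_pos// /oneDsqr.
  rewrite -natr1 addrC lerD2l (@le_trans _ _ (n%:R ^+ 2))//.
    by rewrite -natrX ler_nat leq_pmulr//; near: n; exact: nbhs_infty_gt.
  by rewrite -[leRHS]ger0_norm ?sqr_ge0// normrX lerXn2r ?nnegrE.
- exact: cvg_cst.
- rewrite -[X in _ --> X](mulr0 C); apply: cvgMr; exact: cvg_harmonic.
Unshelve. all: by end_near. Qed.

(** The boundary terms vanish because of the decay. *)
Lemma integral_derivative_eq0 (F f : R -> R) :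
  (forall x : R, is_derive x 1 F (f x)) -> continuous f ->
  decays F -> decays f -> \int[mu]_x f x = 0.
Proof.
move=> dF cf hF hf.
have mf : measurable_fun setT f by exact: continuous_measurable_fun.
have intf := decays_integrable mf hf.
pose I (n : nat) := (`[- n.+1%:R, n.+1%:R] : set R)%classic.
have cI : (\int[mu]_x ((f \_ (I n)) x)%:E)%E @[n --> \oo] --> (\int[mu]_x (f x)%:E)%E.
  apply: (@dominated_cvg _ _ _ mu setT measurableT _ _ (fun x => `|f x|%:E)).
  - move=> n; apply/measurable_EFinP; apply/(measurable_restrictT f) => //.
      exact: measurable_itv.
    exact: measurable_funS mf.
  - move=> x _; apply: cvg_EFin; first by near=> n.
    apply: cvg_near_cst; near=> n.
    rewrite /= patchE mem_set// /I/= in_itv/= -ler_norml.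
    rewrite (@le_trans _ _ n%:R) ?ler_nat//.
    by near: n; exact: nbhs_infty_ger.
  - by move=> x _.
  - by have := integrable_abse intf.
  - move=> n x _; rewrite lee_fin patchE; case: ifPn => // _.
    by rewrite normr0.
have eI n : (\int[mu]_x ((f \_ (I n)) x)%:E)%E = (F n.+1%:R - F (- n.+1%:R))%:E.
  transitivity (\int[mu]_(x in I n) (f x)%:E)%E.
    by rewrite [RHS]integral_mkcond restrict_EFin.
  rewrite EFinB.
  apply: continuous_FTC2.
  - by rewrite gtrN.
  - exact: continuous_subspaceT.
  - have cF x : {for x, continuous F}.
      by apply: differentiable_continuous; apply/derivable1_diffP; case: (dF x).
    split.
    + by move=> x _; case: (dF x).
    + by apply: cvg_at_right_filter; exact: cF.
    + by apply: cvg_at_left_filter; exact: cF.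
  - by move=> x _; rewrite derive1E; case: (dF x).
have c0 : (F n.+1%:R - F (- n.+1%:R))%:E @[n --> \oo] --> (0 : R)%:E.
  apply: cvg_EFin; first by near=> n.
  rewrite -[X in _ --> X]subr0; apply: cvgB.
    by apply: (@decays_cvg0 F) => // n; rewrite ger0_norm ?ler_nat.
  by apply: (@decays_cvg0 F) => // n; rewrite normrN ger0_norm ?ler_nat.
rewrite /Rintegral.
have -> : (\int[mu]_x (f x)%:E = 0)%E.
  apply: cvg_unique cI _ => //.
  apply: cvg_trans c0; apply: near_eq_cvg; near=> n.
  by rewrite -eI.
by [].
Unshelve. all: by end_near. Qed.

End line.

(** * Derivatives of real functions *)

Section calculus.
Context {R : realType}.
Implicit Types (f g : R -> R) (x : R).

Lemma der_M f g x df dg : is_derive x (1:R) f df -> is_derive x (1:R) g dg ->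
  is_derive x (1:R) (fun y => f y * g y) (df * g x + f x * dg).
Proof.
move=> hf hg; apply: (is_derive_eq (is_deriveM hf hg)).
by rewrite /GRing.scale/= addrC (mulrC df).
Qed.

Lemma der_D f g x df dg : is_derive x (1:R) f df -> is_derive x (1:R) g dg ->
  is_derive x (1:R) (fun y => f y + g y) (df + dg).
Proof. by move=> hf hg; exact: is_deriveD. Qed.

Lemma der_B f g x df dg : is_derive x (1:R) f df -> is_derive x (1:R) g dg ->
  is_derive x (1:R) (fun y => f y - g y) (df - dg).
Proof. by move=> hf hg; exact: is_deriveB. Qed.

Lemma der_cst c x : is_derive x (1:R) (fun=> c) (0:R).
Proof. exact: is_derive_cst. Qed.

Lemma der_id x : is_derive x (1:R) (fun y => y) (1:R).
Proof. exact: is_derive_id. Qed.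

Lemma der_Z f c x df : is_derive x (1:R) f df ->
  is_derive x (1:R) (fun y => c * f y) (c * df).
Proof. by move=> hf; exact: is_deriveZ. Qed.

Lemma der_comp f g x df dg : is_derive (g x) (1:R) f df -> is_derive x (1:R) g dg ->
  is_derive x (1:R) (fun y => f (g y)) (df * dg).
Proof. by move=> hf hg; exact: is_derive1_comp. Qed.

Lemma der_sqr x : is_derive x (1:R) (fun y => y ^+ 2) (2 * x).
Proof.
apply: (is_derive_eq (der_M (der_id x) (der_id x))).
by ring.
Qed.

Lemma der_continuous f (f' : R -> R) :
  (forall x, is_derive x (1:R) f (f' x)) -> continuous f.
Proof.
move=> df x; apply: differentiable_continuous.
by apply/derivable1_diffP; case: (df x).
Qed.

Lemma der_derive1 f (f' : R -> R) :
  (forall x, is_derive x (1:R) f (f' x)) -> f^`()%classic = f'.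
Proof. by move=> df; apply/funext => x; rewrite derive1E; case: (df x). Qed.

Lemma le_at0 f (f' : R -> R) :
  (forall x, is_derive x (1:R) f (f' x)) ->
  (forall x, f' x * x <= 0) -> forall x, f x <= f 0.
Proof.
move=> df sf x; have f'E := der_derive1 df.
have dvb y : derivable f y 1 by case: (df y).
have cf : continuous f := der_continuous df.
have [x0|x0] := leP 0 x.
- apply: (@ler0_derive1_nincr _ f 0 x) => //.
  + move=> y; rewrite in_itv/= => /andP[y0 _]; rewrite f'E.
    by rewrite -(pmulr_lle0 _ y0).
  + exact: continuous_subspaceT.
- apply: (@ger0_derive1_ndecr _ f x 0) => //.
  + move=> y; rewrite in_itv/= => /andP[_ y0]; rewrite f'E.
    by rewrite -(nmulr_lle0 _ y0).
  + exact: continuous_subspaceT.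
  + exact: ltW.
Qed.

End calculus.

(** * Hermite functions *)

Section hermite.
Context {R : realType}.
Local Notation h := (@hermite_fun R).
Implicit Types (x y : R) (n : nat).

(** The iterated derivatives of [exp (- x ^ 2)], by the recurrence that the
    Leibniz rule gives for the derivatives of [- 2 x exp (- x ^ 2)]. *)
Fixpoint gauss_der n x : R :=
  match n with
  | 0 => expR (- x ^+ 2)
  | m.+1 => match m with
    | 0 => - 2 * x * expR (- x ^+ 2)
    | p.+1 => - 2 * x * gauss_der m x - 2 * m%:R * gauss_der p x
    end
  end.

Lemma gauss_derSS n x : gauss_der n.+2 x =
  - 2 * x * gauss_der n.+1 x - 2 * n.+1%:R * gauss_der n x.
Proof. by []. Qed.

Lemma is_derive_gauss_der n x :
  is_derive x (1:R) (gauss_der n) (gauss_der n.+1 x).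
Proof.
have d0 y : is_derive y (1:R) (gauss_der 0) (gauss_der 1 y).
  have d1 : is_derive y (1:R) (fun y => - y ^+ 2) (- (2 * y)).
    by apply: is_deriveN; exact: der_sqr.
  apply: (is_derive_eq (der_comp (is_derive_expR _) d1)) => /=.
  by rewrite mulrC mulNr.
suff [] : is_derive x (1:R) (gauss_der n) (gauss_der n.+1 x) /\
  is_derive x (1:R) (gauss_der n.+1) (gauss_der n.+2 x) by [].
elim: n => [|n [IH1 IH2]].
- split; first exact: d0.
  apply: (is_derive_eq (der_M (der_Z (-2) (der_id x)) (d0 x))) => /=.
  by ring.
- split => //.
  apply: (is_derive_eq
    (der_B (der_M (der_Z (-2) (der_id x)) IH2) (der_Z (2 * n.+1%:R) IH1))).
  rewrite [RHS]gauss_derSS -[in RHS]natr1; set u := gauss_der n.+2 x.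
  by ring.
Qed.

Lemma derive1n_gauss n :
  derive1n n (fun y : R => expR (- y ^+ 2)) = gauss_der n.
Proof.
elim: n => [//|n IH]; rewrite derive1nS IH.
by apply: der_derive1 => x; exact: is_derive_gauss_der.
Qed.

Lemma hermite_funE n x :
  h n x = (-1) ^+ n * hermite_gamma R n * expR (x ^+ 2 / 2) * gauss_der n x.
Proof. by rewrite /hermite_fun derive1n_gauss. Qed.

(** The constants of the ladder operators [d/dx + x] and [- d/dx + x] on the
    Hermite functions. *)
Definition ladder n : R := Num.sqrt (2 * n%:R).

Lemma ladder0 : ladder 0 = 0. Proof. by rewrite /ladder mulr0 sqrtr0. Qed.

Lemma ladder_gt0 n : 0 < ladder n.+1.
Proof. by rewrite sqrtr_gt0 mulr_gt0. Qed.

Lemma ladder_ge0 n : 0 <= ladder n. Proof. exact: sqrtr_ge0. Qed.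

Lemma ladder_sqr n : ladder n ^+ 2 = 2 * n%:R.
Proof. by rewrite sqr_sqrtr// mulr_ge0. Qed.

Lemma ladder_le m n : (m <= n)%N -> ladder m <= ladder n.
Proof. by move=> mn; rewrite ler_sqrt ?mulr_ge0// ler_wpM2l// ler_nat. Qed.

Lemma hermite_gammaS n : hermite_gamma R n = hermite_gamma R n.+1 * ladder n.+1.
Proof.
rewrite /hermite_gamma /ladder sqrtrM// factS natrM powRM//.
have -> : (2 : R) `^ (- (n%:R / 2)) = 2 `^ (- (n.+1%:R / 2)) * Num.sqrt 2.
  rewrite -powR12_sqrt// -powRD; last by apply/implyP => _.
  by congr (_ `^ _); rewrite -natr1; field.
have -> : (n.+1%:R : R) `^ (- 2^-1) = (Num.sqrt n.+1%:R)^-1.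
  by rewrite powRN powR12_sqrt.
have : Num.sqrt (n.+1%:R : R) != 0 by rewrite gt_eqF// sqrtr_gt0.
by move=> ?; field.
Qed.

Lemma hermite_fun_recS n x :
  ladder n.+2 * h n.+2 x = 2 * x * h n.+1 x - ladder n.+1 * h n x.
Proof.
rewrite !hermite_funE gauss_derSS (hermite_gammaS n) (hermite_gammaS n.+1).
set e := expR _; rewrite !exprS.
have := ladder_sqr n.+1; set g := hermite_gamma _ _; move=> ls.
rewrite (_ : ladder n.+1 * _ =
  ladder n.+1 ^+ 2 * ((-1) ^+ n * (g * ladder n.+2) * e * gauss_der n x)).
  by rewrite ls; ring.
by ring.
Qed.

(** At [n = 0] the junk index [n.-1] is harmless, since [ladder 0 = 0]; the same
    convention is used in the statements below. *)
Lemma hermite_fun_rec n x :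
  ladder n.+1 * h n.+1 x = 2 * x * h n x - ladder n * h n.-1 x.
Proof.
case: n => [|n]; last exact: hermite_fun_recS.
rewrite ladder0 mul0r subr0 !hermite_funE (hermite_gammaS 0) expr0 expr1.
rewrite /gauss_der. by ring.
Qed.

Lemma hermite_fun_raise n x :
  is_derive x (1:R) (h n) (x * h n x - ladder n.+1 * h n.+1 x).
Proof.
have d2 : is_derive x (1:R) (fun y => y ^+ 2 / 2) x.
  apply: (is_derive_eq (der_M (der_sqr x) (der_cst 2^-1 x))) => /=.
  by field.
have d3 := der_comp (is_derive_expR _) d2.
have d4 := der_M (der_Z ((-1) ^+ n * hermite_gamma R n) d3) (is_derive_gauss_der n x).
rewrite (_ : h n = (fun y =>
    (-1) ^+ n * hermite_gamma R n * expR (y ^+ 2 / 2) * gauss_der n y)).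
  apply: (is_derive_eq d4); rewrite !hermite_funE (hermite_gammaS n).
  set e := expR _; rewrite exprS; set a := gauss_der n.+1 x; by ring.
by apply/funext => y; rewrite hermite_funE.
Qed.

Lemma hermite_fun_lower n x :
  is_derive x (1:R) (h n) (ladder n * h n.-1 x - x * h n x).
Proof.
by apply: (is_derive_eq (hermite_fun_raise n x)); rewrite hermite_fun_rec; ring.
Qed.

Lemma hermite_fun_mulX n x :
  x * h n x = (ladder n * h n.-1 x + ladder n.+1 * h n.+1 x) / 2.
Proof. by rewrite hermite_fun_rec; field. Qed.

Lemma continuous_hermite n : continuous (h n).
Proof. exact: der_continuous (hermite_fun_raise n). Qed.

Lemma hermite_fun0 x : h 0 x = hermite_gamma R 0 * expR (- (x ^+ 2 / 2)).
Proof.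
rewrite hermite_funE /= mul1r -mulrA -expRD; congr (_ * expR _); by field.
Qed.

Lemma hermite_gamma0_itv : 0 < hermite_gamma R 0 <= 1.
Proof.
rewrite /hermite_gamma mul0r oppr0 powRr0 fact0 powR1 !mulr1.
have p1 : 1 <= (pi : R) by rewrite (le_trans _ (pi_ge2 _))// ler1n.
rewrite powR_gt0 ?pi_gt0//= powRN invf_le1 ?powR_gt0 ?pi_gt0//.
have : 1 `^ 4^-1 <= (pi : R) `^ 4^-1.
  by rewrite ge0_ler_powR// ?nnegrE// (le_trans ler01 p1).
by rewrite powR1.
Qed.

(** At the origin the recurrence links [h_{n+1}] to [h_{n-1}] by a factor at
    most 1. *)
Lemma hermite_at0 n : `|h n 0| <= 1.
Proof.
suff [] : `|h n 0| <= 1 /\ `|h n.+1 0| <= 1 by [].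
elim: n => [|n [IH0 IH1]]; split => //.
- rewrite hermite_fun0 expr0n mul0r oppr0 expR0 mulr1.
  by have /andP[g0 g1] := hermite_gamma0_itv; rewrite gtr0_norm.
- have := hermite_fun_rec 0 0; rewrite ladder0 mulr0 !mul0r subr0 => /eqP.
  by rewrite mulf_eq0 gt_eqF ?ladder_gt0//= => /eqP ->; rewrite normr0.
- have /(congr1 Num.norm) := hermite_fun_rec n.+1 0.
  rewrite mulr0 mul0r sub0r normrN !(normrM (ladder _)) !(ger0_norm (ladder_ge0 _)).
  rewrite -[n.+1.-1]/n => E.
  rewrite -(ler_pM2l (ladder_gt0 n.+1)) E mulr1.
  rewrite (le_trans (ler_wpM2l (ladder_ge0 _) IH0))// mulr1.
  exact: ladder_le.
Qed.

(** The quadratic form is the energy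
    [h' ^ 2 + (2 n + 1 - x ^ 2) h ^ 2] of the Hermite equation
    [h'' + (2 n + 1 - x ^ 2) h = 0]; it decreases away from the origin. *)
Lemma hermite_energy_le n x :
  (ladder n.+1 * h n x - x * h n.+1 x) ^+ 2
    + (ladder n.+1 ^+ 2 + 1 - x ^+ 2) * h n.+1 x ^+ 2
  <= (ladder n.+1 * h n 0) ^+ 2 + (ladder n.+1 ^+ 2 + 1) * h n.+1 0 ^+ 2.
Proof.
set u := h n.+1; set v := h n; set s := ladder n.+1.
pose E y := (s * v y - y * u y) ^+ 2 + (s ^+ 2 + 1 - y ^+ 2) * u y ^+ 2.
have du y : is_derive y (1:R) u (s * v y - y * u y) := hermite_fun_lower n.+1 y.
have dv y : is_derive y (1:R) v (y * v y - s * u y) := hermite_fun_raise n y.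
have dE y : is_derive y (1:R) E (- (2 * y * u y ^+ 2)).
  have d1 := der_B (der_Z s (dv y)) (der_M (der_id y) (du y)).
  have d2 := der_B (der_cst (s ^+ 2 + 1) y) (der_sqr y).
  have d3 := der_D (der_M d1 d1) (der_M d2 (der_M (du y) (du y))).
  by apply: (is_derive_eq d3); ring.
have sE y : - (2 * y * u y ^+ 2) * y <= 0.
  rewrite (_ : - (2 * y * u y ^+ 2) * y = - (2 * (y * u y) ^+ 2)); last by ring.
  by rewrite oppr_le0 mulr_ge0 ?sqr_ge0.
by have := le_at0 dE sE x; rewrite /E mul0r subr0 (expr0n _ 2) subr0.
Qed.

(** At [x] the energy controls [(2 n + 1 - x ^ 2) h ^ 2]; at the origin it is at
    most [4 n + 1]. *)
Lemma hermite_fun_le2 n x : (0 < n)%N -> x ^+ 2 <= n%:R -> `|h n x| <= 2.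
Proof.
case: n => // n _ xn; have := hermite_energy_le n x; rewrite /=.
rewrite [(_ * h n 0) ^+ 2]exprMn ladder_sqr.
have u0 : h n.+1 0 ^+ 2 <= 1.
  by rewrite -real_normK ?num_real// expr_le1// hermite_at0.
have v0 : h n 0 ^+ 2 <= 1.
  by rewrite -real_normK ?num_real// expr_le1// hermite_at0.
set N := n.+1%:R in xn *; have N0 : 0 <= N by [].
set q := (_ - _) ^+ 2; have q0 : 0 <= q by exact: sqr_ge0.
set u := h n.+1 x => E.
have : u ^+ 2 <= 2 ^+ 2.
  have p : 0 < N + 1 by rewrite ltr_wpDl.
  rewrite -(ler_pM2r p).
  have uu : 0 <= u ^+ 2 by exact: sqr_ge0.
  have k1 : 0 <= N * (1 - h n 0 ^+ 2) by rewrite mulr_ge0 ?subr_ge0.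
  have k2 : 0 <= N * (1 - h n.+1 0 ^+ 2) by rewrite mulr_ge0 ?subr_ge0.
  have k3 : 0 <= (N - x ^+ 2) * u ^+ 2 by rewrite mulr_ge0 ?subr_ge0.
  by lra.
by move=> u2; rewrite -[leRHS]ger0_norm// -(ler_pXn2r (n := 2))// ?nnegrE// !real_normK ?num_real.
Qed.

(** The recurrence trades an index for a power of [x], so that only the Gaussian
    has to be estimated. *)
Lemma hermite_decay n j : exists C : R, forall x, `|x| ^+ j * `|h n x| <= C.
Proof.
suff : forall j, (exists C : R, forall x, `|x| ^+ j * `|h n x| <= C) /\
  (exists C : R, forall x, `|x| ^+ j * `|h n.+1 x| <= C) by case/(_ j).
have step m k : (exists C : R, forall x, `|x| ^+ k.+1 * `|h m x| <= C) ->
    (exists C : R, forall x, `|x| ^+ k * (ladder m * `|h m.-1 x|) <= C) ->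
    exists C : R, forall x, `|x| ^+ k * `|h m.+1 x| <= C.
  move=> [C1 h1] [C2 h2]; exists ((2 * C1 + C2) / ladder m.+1) => x.
  rewrite ler_pdivlMr ?ladder_gt0//.
  have := congr1 Num.norm (hermite_fun_rec m x).
  rewrite normrM (gtr0_norm (ladder_gt0 _)) => E.
  rewrite -mulrA [_ * ladder _]mulrC E (le_trans (ler_wpM2l _ (ler_normB _ _)))//.
  rewrite mulrDr lerD//.
    rewrite (_ : _ * _ = 2 * (`|x| ^+ k.+1 * `|h m x|)) ?ler_pM2l//.
    by rewrite (normrM (2 * x)) (normrM 2) (ger0_norm (ler0n _ 2)) exprS; ring.
  by rewrite normrM (ger0_norm (ladder_ge0 _)).
elim: n => [|n IH] {}j.
- have h0 k : exists C : R, forall x, `|x| ^+ k * `|h 0 x| <= C.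
    exists ((2 * k.+1%:R) ^+ k.+1) => x.
    rewrite hermite_fun0 normrM; have /andP[g0 g1] := hermite_gamma0_itv.
    rewrite (gtr0_norm g0) (ger0_norm (expR_ge0 _)).
    apply: (@le_trans _ _ (`|x| ^+ k * expR (- (x ^+ 2 / 2)))).
      by rewrite ler_wpM2l// -[leRHS]mul1r ler_wpM2r// expR_ge0.
    rewrite expRN ler_pdivrMr ?expR_gt0//.
    (* [1 + u <= exp u] at [u = x ^ 2 / (2 (k + 1))], to the power [k + 1] *)
    apply: (@le_trans _ _ ((1 + x ^+ 2) ^+ k.+1)).
      have x1 : 1 <= 1 + x ^+ 2 by rewrite lerDl sqr_ge0.
      rewrite -[leLHS]mulr1 exprSr ler_pM//.
      apply: lerXn2r; rewrite ?nnegrE ?(le_trans ler01 x1)//.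
      rewrite -(real_normK (num_real x)); have := normr_ge0 x; set t := `|x| => t0.
      by nra.
    have k0 : 0 < 2 * k.+1%:R :> R by rewrite mulr_gt0.
    have -> : expR (x ^+ 2 / 2) = expR (x ^+ 2 / (2 * k.+1%:R)) ^+ k.+1.
      rewrite -expRM_natl; congr expR.
      have : (k.+1%:R : R) != 0 by rewrite pnatr_eq0.
      by move: (k.+1%:R : R) => K K0; field.
    rewrite -exprMn lerXn2r ?nnegrE ?addr_ge0 ?sqr_ge0 ?mulr_ge0 ?expR_ge0//.
    rewrite (le_trans _ (ler_wpM2l (ltW k0) (expR_ge1Dx _)))//.
    rewrite mulrDr mulr1 mulrCA mulfV ?gt_eqF// mulr1 lerD2r.
    by rewrite -natrM ler1n.
  split=> //; apply: step => //.
  by exists 0 => x; rewrite ladder0 mul0r mulr0.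
- split; first by case: (IH j).
  apply: step; first by case: (IH j.+1).
  have [[C hC] _] := IH j; exists (ladder n.+1 * C) => x.
  by rewrite mulrCA ler_wpM2l ?ladder_ge0.
Qed.

End hermite.

(** * Hermite coefficients and partial sums *)

Section coefficients.
Context {R : realType}.
Notation mu := (@lebesgue_measure R).
Local Notation h := (@hermite_fun R).
Local Notation W := (@oneDsqr R).
Local Notation ladder := (@ladder R).
Implicit Types (x y : R) (n : nat).

(** Polynomial growth makes every Hermite coefficient converge, and the class is
    stable under multiplication by [y]. *)
Definition tempered (g : R -> R) := continuous g /\
  exists j : nat, exists2 C : R, 0 <= C & forall x, `|g x| <= C * (1 + `|x|) ^+ j.

Lemma one_abs_ge1 x : 1 <= 1 + `|x|. Proof. by rewrite lerDl. Qed.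

Lemma one_abs_ge0 x : 0 <= 1 + `|x|.
Proof. by rewrite (le_trans ler01)// one_abs_ge1. Qed.

Lemma tempered_bounded (g : R -> R) (C : R) :
  continuous g -> (forall x, `|g x| <= C) -> tempered g.
Proof.
move=> cg gC; split => //; exists 0; exists C => [|x]; last by rewrite expr0 mulr1.
exact: le_trans (gC 0).
Qed.

Lemma tempered_cst c : tempered (fun=> c).
Proof. by apply: (@tempered_bounded _ `|c|) => //; exact: cst_continuous. Qed.

Lemma tempered_id : tempered (fun y => y).
Proof.
split; first by move=> x; exact: cvg_id.
by exists 1; exists 1 => // x; rewrite mul1r expr1 lerDr.
Qed.

Lemma tempered_D f g : tempered f -> tempered g -> tempered (fun y => f y + g y).
Proof.
move=> [cf [i [C C0 fC]]] [cg [j [D D0 gD]]]; split.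
  by move=> x; apply: cvgD; [exact: cf|exact: cg].
exists (i + j); exists (C + D); first exact: addr_ge0.
move=> x; rewrite mulrDl (le_trans (ler_normD _ _))// lerD//.
  rewrite (le_trans (fC _))// ler_wpM2l// ler_weXn2l ?leq_addr//.
  exact: one_abs_ge1.
rewrite (le_trans (gD _))// ler_wpM2l// ler_weXn2l ?leq_addl//.
exact: one_abs_ge1.
Qed.

Lemma tempered_M f g : tempered f -> tempered g -> tempered (fun y => f y * g y).
Proof.
move=> [cf [i [C C0 fC]]] [cg [j [D D0 gD]]]; split.
  by move=> x; apply: cvgM; [exact: cf|exact: cg].
exists (i + j); exists (C * D); first exact: mulr_ge0.
by move=> x; rewrite normrM exprD mulrACA ler_pM.
Qed.

Lemma tempered_hermite n : tempered (h n).
Proof.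
have [C hC] := @hermite_decay R n 0.
have hb x : `|h n x| <= C by rewrite -[leLHS]mul1r; exact: hC.
exact: tempered_bounded (@continuous_hermite R n) hb.
Qed.

Lemma hermite_decayX n j : exists C : R, forall x, (1 + `|x|) ^+ j * `|h n x| <= C.
Proof.
have [C0 h0] := @hermite_decay R n 0; have [C1 h1] := @hermite_decay R n j.
exists (2 ^+ j * (C0 + C1)) => x.
apply: (@le_trans _ _ (2 ^+ j * ((1 + `|x| ^+ j) * `|h n x|))); last first.
  rewrite ler_wpM2l ?exprn_ge0// mulrDl lerD//.
  by have := h0 x; rewrite expr0.
rewrite mulrA ler_wpM2r//; have [x1|x1] := leP `|x| 1.
  apply: (@le_trans _ _ (2 ^+ j)); last by rewrite ler_peMr ?lerDl// exprn_ge0.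
  by rewrite lerXn2r ?nnegrE ?one_abs_ge0//; lra.
apply: (@le_trans _ _ ((2 * `|x|) ^+ j)).
  by rewrite lerXn2r ?nnegrE ?one_abs_ge0 ?mulr_ge0//; lra.
by rewrite exprMn ler_wpM2l ?exprn_ge0// lerDr.
Qed.

Lemma decays_tempered_hermite g n : tempered g -> decays (fun y => g y * h n y).
Proof.
move=> [_ [j [C C0 gC]]]; have [D hD] := hermite_decayX n j.+2.
exists (C * D) => x; rewrite normrM.
have WX : W x <= (1 + `|x|) ^+ 2.
  by rewrite /oneDsqr -(real_normK (num_real x)) sqrrD expr1n lerD2r lerDl mulrn_wge0 ?mul1r.
apply: (@le_trans _ _ (C * (1 + `|x|) ^+ j * `|h n x| * (1 + `|x|) ^+ 2)).
  by rewrite ler_pM ?mulr_ge0 ?(ltW (oneDsqr_pos _))// ler_wpM2r.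
have -> : C * (1 + `|x|) ^+ j * `|h n x| * (1 + `|x|) ^+ 2 =
    C * ((1 + `|x|) ^+ j.+2 * `|h n x|).
  by rewrite !exprS; move: `|h n x| => t; ring.
by rewrite ler_wpM2l.
Qed.

Lemma continuous_tempered_hermite g n :
  tempered g -> continuous (fun y => g y * h n y).
Proof.
by move=> [cg _] x; apply: cvgM; [exact: cg|exact: continuous_hermite].
Qed.

Lemma integrable_tempered_hermite g n : tempered g ->
  mu.-integrable setT (EFin \o (fun y => g y * h n y)).
Proof.
move=> tg; apply: decays_integrable; last exact: decays_tempered_hermite.
by apply: continuous_measurable_fun; exact: continuous_tempered_hermite.
Qed.

Lemma hermite_coefE g n : continuous g ->
  hermite_coef g n = \int[mu]_y (g y * h n y).
Proof.
move=> cg; rewrite /hermite_coef /Rintegral integral_completed//.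
apply/measurable_EFinP; apply: continuous_measurable_fun => x.
by apply: cvgM; [exact: cg|exact: continuous_hermite].
Qed.

Lemma hermite_coefD f g n : tempered f -> tempered g ->
  hermite_coef (fun y => f y + g y) n = hermite_coef f n + hermite_coef g n.
Proof.
move=> tf tg; have [cf _] := tf; have [cg _] := tg; have [cfg _] := tempered_D tf tg.
rewrite !hermite_coefE//; under eq_Rintegral => y _ do rewrite mulrDl.
by rewrite RintegralD//; exact: integrable_tempered_hermite.
Qed.

Lemma hermite_coefZ c g n : tempered g ->
  hermite_coef (fun y => c * g y) n = c * hermite_coef g n.
Proof.
move=> tg; have [cg _] := tg; have [ccg _] := tempered_M (tempered_cst c) tg.
rewrite !hermite_coefE//; under eq_Rintegral => y _ do rewrite -mulrA.
by rewrite RintegralZl//; exact: integrable_tempered_hermite.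
Qed.

Lemma hermite_coefB f g n : tempered f -> tempered g ->
  hermite_coef (fun y => f y - g y) n = hermite_coef f n - hermite_coef g n.
Proof.
move=> tf tg.
have := hermite_coefD n tf (tempered_M (tempered_cst (-1)) tg).
rewrite hermite_coefZ// mulN1r => <-.
by congr (hermite_coef _ _); apply/funext => y; rewrite mulN1r.
Qed.

Lemma hermite_coef_mulX g n : tempered g ->
  hermite_coef (fun y => y * g y) n =
  (ladder n * hermite_coef g n.-1 + ladder n.+1 * hermite_coef g n.+1) / 2.
Proof.
move=> tg; have [cg _] := tg; have [cyg _] := tempered_M tempered_id tg.
have P y : y * g y * h n y =
    ladder n / 2 * (g y * h n.-1 y) + ladder n.+1 / 2 * (g y * h n.+1 y).
  have := hermite_fun_mulX n y.
  move: (h n y) (h n.-1 y) (h n.+1 y) => u v w E.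
  by rewrite -mulrA mulrCA E; field.
rewrite !hermite_coefE//; under eq_Rintegral => y _ do rewrite P.
have iZ c k := integrableZl measurableT c (integrable_tempered_hermite k tg).
rewrite RintegralD//; [|exact: iZ|exact: iZ].
rewrite !RintegralZl//; try exact: integrable_tempered_hermite.
by field.
Qed.

(** Integration by parts against the creation operator: [d/dx + x] is the adjoint
    of [- d/dx + x], which maps [h_n] to [ladder n.+1] times [h_{n+1}]. *)
Lemma hermite_coef_raise g g' n :
  (forall y, is_derive y (1:R) g (g' y)) -> tempered g -> tempered g' ->
  ladder n.+1 * hermite_coef g n.+1 = hermite_coef (fun y => g' y + y * g y) n.
Proof.
move=> dg tg tg'; have [cg _] := tg.
have tyg := tempered_M tempered_id tg; have ts := tempered_D tg' tyg.
have tlg := tempered_M (tempered_cst (ladder n.+1)) tg.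
apply/eqP; rewrite eq_sym -subr_eq0 -hermite_coefZ//.
have [cs _] := ts; have [clg _] := tlg.
rewrite !hermite_coefE// -RintegralB//; try exact: integrable_tempered_hermite.
apply/eqP.
have d1 (y : R) : is_derive y (1:R) (fun y => g y * h n y)
    ((g' y + y * g y) * h n y - ladder n.+1 * g y * h n.+1 y).
  apply: (is_derive_eq (der_M (dg y) (hermite_fun_raise n y))).
  by move: (h n y) (h n.+1 y) => u v; ring.
have c1 : continuous (fun y => (g' y + y * g y) * h n y - ladder n.+1 * g y * h n.+1 y).
  move=> y; have k1 := continuous_tempered_hermite (n := n) ts (x := y).
  have k2 := continuous_tempered_hermite (n := n.+1) tlg (x := y).
  exact: (cvgB k1 k2).
have e2 : decays (fun y => (g' y + y * g y) * h n y - ladder n.+1 * g y * h n.+1 y).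
  have [C1 h1] := decays_tempered_hermite n ts.
  have [C2 h2] := decays_tempered_hermite n.+1 tlg.
  exists (C1 + C2) => y; rewrite (le_trans _ (lerD (h1 y) (h2 y)))//.
  by rewrite -mulrDl ler_wpM2r ?(ltW (oneDsqr_pos _))// ler_normB.
exact: (integral_derivative_eq0 d1 c1 (decays_tempered_hermite n tg) e2).
Qed.

(** Applied to a Hermite function, the integration by parts lowers both indices;
    this is where orthonormality comes from. *)
Lemma hermite_coef_shift n k :
  ladder n.+1 * hermite_coef (h k) n.+1 = ladder k * hermite_coef (h k.-1) n.
Proof.
have th := tempered_hermite k; have tx := tempered_M tempered_id th.
rewrite (hermite_coef_raise n (hermite_fun_lower k)) //.
  rewrite -hermite_coefZ; last exact: tempered_hermite.
  by congr (hermite_coef _ _); apply/funext => y; rewrite subrK.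
have := tempered_D (tempered_M (tempered_cst (ladder k)) (tempered_hermite k.-1))
  (tempered_M (tempered_cst (-1)) tx).
by congr tempered; apply/funext => y; rewrite mulN1r.
Qed.

Lemma hermite_coef_fun0 : hermite_coef (h 0) 0 = 1.
Proof.
rewrite hermite_coefE; last exact: continuous_hermite.
under eq_Rintegral => y _.
  rewrite hermite_fun0 mulrACA -expRD -expr2.
  rewrite (_ : _ + _ = - y ^+ 2); last by field.
  over.
rewrite RintegralZl//; last exact: integrableT_gauss.
rewrite /Rintegral integralT_gauss /= /hermite_gamma.
rewrite mul0r oppr0 powRr0 fact0 powR1 !mulr1 expr2 -powRD; last first.
  by apply/implyP => _; rewrite gt_eqF// pi_gt0.
rewrite -opprD (_ : 4^-1 + 4^-1 = 2^-1 :> R); last by field.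
by rewrite powRN powR12_sqrt ?pi_ge0// mulVf// gt_eqF// sqrtr_gt0 pi_gt0.
Qed.

Lemma hermite_coef_norm n : hermite_coef (h n) n = 1.
Proof.
elim: n => [|n IH]; first exact: hermite_coef_fun0.
have := hermite_coef_shift n n.+1; rewrite IH => /(mulfI _); apply.
by rewrite gt_eqF// ladder_gt0.
Qed.

Lemma hermite_coef_fun0S n : hermite_coef (h 0) n.+1 = 0.
Proof.
have := hermite_coef_shift n 0; rewrite ladder0 mul0r => /eqP.
by rewrite mulf_eq0 gt_eqF ?ladder_gt0//= => /eqP.
Qed.

Lemma hermite_sum_fun0 n x : hermite_sum n (h 0) x = h 0 x.
Proof.
rewrite /hermite_sum big_ord_recl /= hermite_coef_fun0 mul1r big1 ?addr0// => i _.
by rewrite hermite_coef_fun0S mul0r.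
Qed.

(** Since [h_n] has norm 1, this is [2 |a b| <= a ^ 2 + b ^ 2] together with
    [int 1 / (1 + y ^ 2) = pi]. *)
Lemma hermite_coef_le p n (M : R) : continuous p -> 0 <= M ->
  (forall y, `|p y| * W y <= M) -> `|hermite_coef p n| <= M * ((pi + 1) / 2).
Proof.
move=> cp M0 pM; rewrite hermite_coefE//.
have W1 y : 1 <= W y by exact: oneDsqr_ge1.
have Wp y : 0 < W y := oneDsqr_pos y.
have tp : tempered p.
  apply: (tempered_bounded (C := M)) => // y.
  by rewrite (le_trans _ (pM y))// ler_peMr.
have intp := integrable_tempered_hermite n tp.
rewrite (le_trans (le_normr_Rintegral _ intp))//.
have int1 : mu.-integrable setT (EFin \o (fun y => (W y)^-1)).
  exact: integrable_oneDsqrV.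
have int2 := integrable_tempered_hermite n (tempered_hermite n).
have int3 : mu.-integrable setT (EFin \o (fun y => (W y)^-1 + h n y * h n y)).
  have := integrableD measurableT int1 int2.
  by apply: eq_integrable.
have int4 := integrableZl measurableT (M / 2) int3.
apply: (@le_trans _ _ (\int[mu]_y (M / 2 * ((W y)^-1 + h n y * h n y)))).
  apply: le_Rintegral => //.
  - by have := integrable_abse intp; apply: eq_integrable.
  - move=> y _; rewrite normrM.
    apply: (@le_trans _ _ (M * ((W y)^-1 * `|h n y|))).
      by rewrite mulrA ler_wpM2r// ler_pdivlMr.
    rewrite -mulrA ler_wpM2l//.
    have w1 : (W y)^-1 <= 1 by rewrite invf_le1.
    have w0 : 0 <= (W y)^-1 by rewrite invr_ge0 ltW.
    have : h n y * h n y = `|h n y| * `|h n y|.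
      by rewrite -!expr2 real_normK ?num_real.
    move=> ->; move: (W y)^-1 w0 w1 (`|h n y|) => w w0 w1 t.
    have := sqr_ge0 (w - t); have : 0 <= w * (1 - w) by rewrite mulr_ge0 ?subr_ge0.
    by rewrite !expr2; lra.
rewrite RintegralZl// RintegralD// -(hermite_coefE n (@continuous_hermite R n)).
rewrite hermite_coef_norm /Rintegral integralT_oneDsqr /=.
by rewrite le_eqVlt; apply/orP; left; apply/eqP; field.
Qed.

(** Christoffel-Darboux, integrated against [q]: the recurrence makes the
    partial sum of [(y - x) q] telescope. *)
Lemma hermite_sum_telescope q n x : tempered q ->
  hermite_sum n (fun y => (y - x) * q y) x =
  ladder n.+1 / 2 * (hermite_coef q n.+1 * h n x - hermite_coef q n * h n.+1 x).
Proof.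
move=> tq.
have E k : hermite_coef (fun y => (y - x) * q y) k =
  (ladder k * hermite_coef q k.-1 + ladder k.+1 * hermite_coef q k.+1) / 2 -
  x * hermite_coef q k.
  rewrite -hermite_coef_mulX// -hermite_coefZ// -hermite_coefB.
  - by congr (hermite_coef _ _); apply/funext => y; rewrite mulrBl.
  - exact: tempered_M tempered_id tq.
  - exact: tempered_M (tempered_cst _) tq.
rewrite /hermite_sum; elim: n => [|n IH].
  rewrite big_ord_recl big_ord0 /= E ladder0 mul0r add0r addr0.
  have := hermite_fun_mulX 0 x; rewrite ladder0 mul0r add0r.
  move: (h 0 x) (h 1 x) => v u xv.
  transitivity (ladder 1 / 2 * hermite_coef q 1 * v - hermite_coef q 0 * (x * v)).
    by field.
  by rewrite xv; field.
rewrite big_ord_recr /= {}IH E /=.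
have := hermite_fun_mulX n.+1 x; rewrite /=.
move: (h n.+2 x) (h n.+1 x) (h n x) => u v w xv.
set c0 := hermite_coef q n; set c1 := hermite_coef q n.+1.
set c2 := hermite_coef q n.+2.
transitivity (ladder n.+1 / 2 * c1 * w + ladder n.+2 / 2 * c2 * v - c1 * (x * v)).
  by field.
by rewrite xv; field.
Qed.

(** Each integration by parts gains a factor [1 / sqrt n]; after two of them the
    integrand is [(d/dy + y) ^ 2 q = q'' + 2 y q' + (1 + y ^ 2) q]. *)
Lemma hermite_coef_smooth_le q q1 q2 n (M : R) :
  (forall y, is_derive y (1:R) q (q1 y)) ->
  (forall y, is_derive y (1:R) q1 (q2 y)) -> continuous q2 ->
  tempered q -> tempered q1 -> tempered q2 -> 0 <= M ->
  (forall y, `|q2 y + 2 * y * q1 y + (1 + y ^+ 2) * q y| * W y <= M) ->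
  `|hermite_coef q n.+2| <= M * ((pi + 1) / 2) / (2 * n.+1%:R).
Proof.
move=> dq dq1 cq2 tq tq1 tq2 M0 hM.
have tx := tempered_id.
have tr : tempered (fun y => q1 y + y * q y).
  by apply: tempered_D => //; exact: tempered_M.
have dr y : is_derive y (1:R) (fun y => q1 y + y * q y) (q2 y + (1 * q y + y * q1 y)).
  by apply: der_D => //; apply: der_M => //; exact: der_id.
have tr' : tempered (fun y => q2 y + (1 * q y + y * q1 y)).
  apply: tempered_D => //; apply: tempered_D; last exact: tempered_M.
  by apply: tempered_M => //; exact: tempered_cst.
have E : ladder n.+1 * ladder n.+2 * hermite_coef q n.+2 =
    hermite_coef (fun y => q2 y + 2 * y * q1 y + (1 + y ^+ 2) * q y) n.
  rewrite -mulrA (hermite_coef_raise n.+1 dq)// (hermite_coef_raise n dr)//.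
  by congr (hermite_coef _ _); apply/funext => y; ring.
have : `|ladder n.+1 * ladder n.+2 * hermite_coef q n.+2| <= M * ((pi + 1) / 2).
  rewrite E; apply: hermite_coef_le => //.
  have [+ _] := tempered_D tr' (tempered_M tx tr); rewrite (_ : (fun=> _) = 
    (fun y => q2 y + 2 * y * q1 y + (1 + y ^+ 2) * q y))//.
  by apply/funext => y; ring.
rewrite normrM gtr0_norm ?mulr_gt0 ?ladder_gt0// => H.
rewrite ler_pdivlMr ?mulr_gt0//; apply: le_trans H.
rewrite mulrC ler_wpM2r// -ladder_sqr expr2 ler_wpM2l ?ladder_ge0//.
exact: ladder_le.
Qed.

(** The two factors [1 / n] from the coefficients beat the factor [sqrt n] of the
    telescoped sum. *)
Lemma hermite_sum_division_le q q1 q2 n (M : R) x :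
  (forall y, is_derive y (1:R) q (q1 y)) ->
  (forall y, is_derive y (1:R) q1 (q2 y)) -> continuous q2 ->
  tempered q -> tempered q1 -> tempered q2 -> 0 <= M ->
  (forall y, `|q2 y + 2 * y * q1 y + (1 + y ^+ 2) * q y| * W y <= M) ->
  x ^+ 2 <= n.+2%:R ->
  `|hermite_sum n.+2 (fun y => (y - x) * q y) x|
    <= M * ((pi + 1) / 2) * 4 / Num.sqrt n.+2%:R.
Proof.
move=> dq dq1 cq2 tq tq1 tq2 M0 hM xn.
set K := M * ((pi + 1) / 2).
have K0 : 0 <= K by rewrite mulr_ge0// divr_ge0// addr_ge0 ?pi_ge0.
have c2 k : `|hermite_coef q k.+2| <= K / (2 * k.+1%:R).
  by apply: hermite_coef_smooth_le dq dq1 _ _ _ _ _ _.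
rewrite hermite_sum_telescope// normrM.
have h2 : `|h n.+2 x| <= 2 by exact: hermite_fun_le2.
have h3 : `|h n.+3 x| <= 2.
  by apply: hermite_fun_le2 => //; rewrite (le_trans xn)// ler_nat.
set s := Num.sqrt n.+2%:R; have s0 : 0 < s by rewrite sqrtr_gt0.
have ss : s ^+ 2 = n.+2%:R by rewrite sqr_sqrtr.
have N1 : (n.+2%:R : R) <= 2 * n.+1%:R by rewrite -natrM ler_nat; lia.
have c3 : `|hermite_coef q n.+3| <= K / n.+2%:R.
  apply: le_trans (c2 n.+1) _; rewrite ler_wpM2l// lef_pV2 ?posrE ?mulr_gt0//.
  by rewrite ler_peMl// ler1n.
have c4 : `|hermite_coef q n.+2| <= K / n.+2%:R.
  by apply: le_trans (c2 n) _; rewrite ler_wpM2l// lef_pV2 ?posrE ?mulr_gt0.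
have l3 : ladder n.+3 <= 2 * s.
  rewrite -(ler_pXn2r (n := 2))// ?nnegrE ?ladder_ge0 ?mulr_ge0 ?(ltW s0)//.
  rewrite ladder_sqr exprMn ss -[n.+3%:R]natr1.
  have ge1 : 1 <= n.+2%:R :> R by rewrite ler1n.
  have -> : 2 ^+ 2 * n.+2%:R = 2 * n.+2%:R + 2 * n.+2%:R :> R by ring.
  by rewrite mulrDr mulr1 lerD2l ler_peMr.
apply: (@le_trans _ _ (s * (4 * (K / n.+2%:R)))).
  apply: ler_pM => //.
    by rewrite ger0_norm ?divr_ge0 ?ladder_ge0// ler_pdivrMr// mulrC.
  rewrite (le_trans (ler_normB _ _))//.
  have mul2 (a b c : R) : `|a| <= c -> `|b| <= 2 -> `|a * b| <= c * 2.
    by move=> ac b2; rewrite normrM ler_pM.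
  have e1 := mul2 _ _ _ c3 h2; have e2 := mul2 _ _ _ c4 h3.
  apply: le_trans (lerD e1 e2) _; move: (K / n.+2%:R) => z.
  by rewrite (_ : z * 2 + z * 2 = 4 * z)//; ring.
rewrite -ss le_eqVlt; apply/orP; left; apply/eqP.
by field; rewrite gt_eqF.
Qed.

End coefficients.

(** * The smooth difference quotient *)

Section division.
Context {R : realType}.
Notation mu := (@lebesgue_measure R).
Implicit Types (x y : R) (g : R -> R).

(** The [k]-th derivative in [y] of the difference quotient
    [(g y - g x) / (y - x)], for [phi] the derivative of order [k + 1] of [g];
    unlike the quotient it is visibly smooth at [y = x]. *)
Definition quotient_der k (phi : R -> R) x y :=
  \int[mu]_(s in `[0, 1]) (s ^+ k * phi (x + s * (y - x))).

Let continuous_integrand k (phi : R -> R) x y : continuous phi ->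
  continuous (fun s : R => s ^+ k * phi (x + s * (y - x))).
Proof.
move=> cp s; apply: cvgM; first exact: exprn_continuous.
apply: (@continuous_comp _ _ _ (fun s : R => x + s * (y - x)) phi); last exact: cp.
apply: cvgD; first exact: cvg_cst.
by apply: cvgMl; exact: cvg_id.
Qed.

Let integrable_integrand k (phi : R -> R) x y : continuous phi ->
  mu.-integrable `[0, 1] (EFin \o (fun s : R => s ^+ k * phi (x + s * (y - x)))).
Proof.
move=> cp; apply: continuous_compact_integrable; first exact: segment_compact.
by apply: continuous_subspaceT; exact: continuous_integrand.
Qed.

Lemma quotient_der_le k (phi : R -> R) x y (C : R) : continuous phi ->
  (forall y, `|phi y| <= C) -> `|quotient_der k phi x y| <= C.
Proof.
move=> cp pC; have iI := integrable_integrand k x y cp.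
have m01 : measurable (`[0, 1] : set (measurableTypeR R))%classic.
  by exact: measurable_itv.
rewrite /quotient_der (le_trans (le_normr_Rintegral m01 iI))//.
have -> : C = \int[mu]_(s in `[0, 1]) (fun=> C) s.
  rewrite Rintegral_cst//; have := lebesgue_measure_itv `[0 : R, 1].
  by rewrite /= lte01 oppr0 adde0 => -> /=; rewrite mulr1.
apply: le_Rintegral => //.
- by have := integrable_abse iI.
- apply: continuous_compact_integrable; first exact: segment_compact.
  by apply: continuous_subspaceT; exact: cst_continuous.
- move=> s; rewrite /= in_itv/= => /andP[s0 s1].
  rewrite normrM -[leRHS]mul1r ler_pM// normrX exprn_ile1// ger0_norm//.
Qed.

(** Differentiation under the integral sign. *)
Lemma is_derive_quotient_der k (phi phi' : R -> R) x y (C : R) :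
  (forall y, is_derive y (1:R) phi (phi' y)) ->
  (forall y, `|phi' y| <= C) ->
  is_derive y (1:R) (quotient_der k phi x) (quotient_der k.+1 phi' x y).
Proof.
move=> dp pC.
have cp : continuous phi by exact: der_continuous dp.
have m01 : measurable (`[0, 1] : set (measurableTypeR R))%classic.
  by exact: measurable_itv.
have Iy : (`]y - 1, y + 1[ : set R)%classic y.
  by rewrite /= in_itv/= ltrBlDr ltrDl ltr01.
pose F (z s : R) := s ^+ k * phi (x + s * (z - x)).
have dF s z : is_derive z (1:R) (F ^~ s) (s ^+ k.+1 * phi' (x + s * (z - x))).
  have d1 : is_derive z (1:R) (fun z => x + s * (z - x)) s.
    apply: (is_derive_eq (der_D (der_cst x z) (der_Z s (der_B (der_id z) (der_cst x z))))).
    by rewrite subr0 add0r mulr1.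
  have d2 := der_comp (f := phi) (g := fun z => x + s * (z - x)) (dp (x + s * (z - x))) d1.
  apply: (is_derive_eq (der_Z (s ^+ k) d2)).
  by rewrite exprS; ring.
have p1 : partial1of2 F = (fun z s => s ^+ k.+1 * phi' (x + s * (z - x))).
  apply/funext => z; apply/funext => s; rewrite /partial1of2.
  by rewrite (der_derive1 (dF s)).
have h1 : forall z, (`]y - 1, y + 1[ : set R)%classic z ->
    mu.-integrable `[0, 1] (EFin \o F z).
  by move=> z _; exact: integrable_integrand.
have h2 : forall z s, (`]y - 1, y + 1[ : set R)%classic z ->
    `[0, 1]%classic s -> derivable (F ^~ s) z 1.
  by move=> z s _ _; case: (dF s z).
have h3 : mu.-integrable `[0, 1] (EFin \o (fun=> C) : R -> \bar R).
  apply: continuous_compact_integrable; first exact: segment_compact.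
  by apply: continuous_subspaceT; exact: cst_continuous.
have C0 : R -> 0 <= C by move=> z; apply: le_trans (pC z).
have h4 : forall z s, (`]y - 1, y + 1[ : set R)%classic z ->
    `[0, 1]%classic s -> `|partial1of2 F z s| <= C.
  move=> z s _; rewrite /= in_itv/= => /andP[s0 s1]; rewrite p1 normrM.
  by rewrite -[leRHS]mul1r ler_pM// normrX exprn_ile1// ger0_norm.
split.
  exact: (derivable_under_integral m01 Iy h1 h2 C0 h3 h4).
rewrite -derive1E.
rewrite (differentiation_under_integral m01 Iy h1 h2 C0 h3 h4).
by rewrite p1.
Qed.

(** The fundamental theorem of calculus along the segment from [x] to [y]. *)
Lemma quotient_derM g g1 x y :
  (forall y, is_derive y (1:R) g (g1 y)) -> continuous g1 ->
  (y - x) * quotient_der 0 g1 x y = g y - g x.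
Proof.
move=> dg cg1; rewrite /quotient_der.
rewrite -RintegralZl//; last exact: integrable_integrand.
pose G (s : R) := g (x + s * (y - x)).
have dG (s : R) : is_derive s (1:R) G ((y - x) * (s ^+ 0 * g1 (x + s * (y - x)))).
  have d1 : is_derive s (1:R) (fun s => x + s * (y - x)) (y - x).
    apply: (is_derive_eq (der_D (der_cst x s) (der_M (der_id s) (der_cst (y - x) s)))).
    by rewrite mulr0 addr0 add0r mul1r.
  have d2 := der_comp (f := g) (g := fun s => x + s * (y - x)) (dg (x + s * (y - x))) d1.
  apply: (is_derive_eq d2).
  by rewrite expr0 mul1r mulrC.
have cG := der_continuous dG.
have cG' : continuous (fun s : R => (y - x) * (s ^+ 0 * g1 (x + s * (y - x)))).
  move=> s; apply: cvgMr; exact: continuous_integrand.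
rewrite /Rintegral (@continuous_FTC2 _ _ G)//.
- by rewrite /G mul0r addr0 mul1r addrCA subrr addr0.
- exact: continuous_subspaceT.
- split.
  + by move=> s _; case: (dG s).
  + by apply: cvg_at_right_filter; exact: cG.
  + by apply: cvg_at_left_filter; exact: cG.
- by move=> s _; rewrite (der_derive1 dG).
Qed.

(** Away from [x] the quotient inherits the decay of [g], near [x] it is
    bounded; [X], [Y], [t] stand for [1 + |x|], [1 + |y|], [|y - x|]. *)
Lemma quotient_weight_le (C X Y t q q1 q2 : R) :
  0 <= C -> 1 <= X -> 1 <= Y -> `|t| <= X * Y -> Y <= X * (1 + `|t|) ->
  `|q| <= C -> `|q1| <= C -> `|q2| <= C ->
  Y ^+ 3 * `|t * q| <= C -> Y ^+ 3 * `|q + t * q1| <= C ->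
  Y ^+ 3 * `|2 * q1 + t * q2| <= C ->
  (`|q2| + 2 * Y * `|q1| + Y ^+ 2 * `|q|) * Y ^+ 2 <= 52 * C * X ^+ 7.
Proof.
move=> C0 X1 Y1 tXY YXt qC q1C q2C g0C g1C g2C.
have X0 : 0 <= X by apply: le_trans X1.
have Y0 : 0 <= Y by apply: le_trans Y1.
set T := `|t| in tXY YXt *; have T0 : 0 <= T by rewrite normr_ge0.
have XY1 : 1 <= X * Y by rewrite -[leLHS]mulr1 ler_pM.
have pw j (a : R) : (j <= 3)%N -> Y ^+ 3 * `|a| <= C -> T ^+ j * `|a| <= C * X ^+ 3.
  move=> j3 aC; apply: (@le_trans _ _ ((X * Y) ^+ 3 * `|a|)).
    rewrite ler_wpM2r//; apply: (@le_trans _ _ ((X * Y) ^+ j)).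
      by rewrite lerXn2r ?nnegrE ?mulr_ge0.
    exact: ler_weXn2l.
  by rewrite exprMn -mulrA mulrC ler_wpM2r ?exprn_ge0.
have CX k : C <= C * X ^+ k by rewrite ler_peMr// exprn_ege1.
have XX j k : (j <= k)%N -> C * X ^+ j <= C * X ^+ k.
  by move=> jk; rewrite ler_wpM2l// ler_weXn2l.
have YX k : Y ^+ k <= X ^+ k * (1 + T) ^+ k.
  by rewrite -exprMn lerXn2r ?nnegrE ?mulr_ge0// addr_ge0.
(* the three powers of [1 + T] needed, against the corresponding monomials *)
have b4 : (1 + T) ^+ 4 <= 8 * (1 + T ^+ 4).
  rewrite -subr_ge0.
  rewrite (_ : _ - _ = (T - 1) ^+ 2 * (7 * T ^+ 2 + 10 * T + 7)); last by ring.
  by rewrite mulr_ge0 ?sqr_ge0// !addr_ge0// mulr_ge0// sqr_ge0.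
have b3 : (1 + T) ^+ 3 <= 4 * (1 + T ^+ 3).
  rewrite -subr_ge0 (_ : _ - _ = 3 * ((T - 1) ^+ 2 * (1 + T))); last by ring.
  by rewrite mulr_ge0// mulr_ge0 ?sqr_ge0// addr_ge0.
have b2 : (1 + T) ^+ 2 <= 2 * (1 + T ^+ 2).
  rewrite -subr_ge0 (_ : _ - _ = (T - 1) ^+ 2); last by ring.
  by rewrite sqr_ge0.
have Tq : T ^+ 4 * `|q| <= C * X ^+ 3.
  by have := pw 3 _ isT g0C; rewrite normrM mulrA -exprSr.
have Tq1' : T * `|q1| <= 2 * C.
  have -> : T * `|q1| = `|(q + t * q1) - q| by rewrite addrC addKr normrM.
  rewrite (le_trans (ler_normB _ _))// mulr_natl mulr2n lerD//.
  by apply: le_trans g1C; rewrite ler_peMl// exprn_ege1.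
have Tq1 : T ^+ 3 * `|q1| <= 2 * (C * X ^+ 3).
  have -> : T ^+ 3 * `|q1| = T ^+ 2 * `|(q + t * q1) - q|.
    by rewrite addrC addKr normrM exprSr mulrA.
  rewrite (le_trans (ler_wpM2l _ (ler_normB _ _))) ?exprn_ge0//.
  rewrite mulrDr mulr_natl mulr2n lerD//; first exact: (pw 2%N).
  by have := pw 1 _ isT g0C; rewrite normrM expr1 mulrA -expr2.
have Tq2 : T ^+ 2 * `|q2| <= 5 * (C * X ^+ 3).
  have -> : T ^+ 2 * `|q2| = T * `|(2 * q1 + t * q2) - 2 * q1|.
    by rewrite addrC addKr normrM expr2 mulrA.
  rewrite (le_trans (ler_wpM2l T0 (ler_normB _ _)))// mulrDr.
  have e1 := pw 1 _ isT g2C; rewrite expr1 in e1.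
  have e2 : T * `|2 * q1| <= 4 * C.
    by rewrite normrM (ger0_norm (ler0n _ 2)) mulrCA; lra.
  by have := CX 3; lra.
have f0 : Y ^+ 4 * `|q| <= 16 * (C * X ^+ 7).
  apply: (@le_trans _ _ (X ^+ 4 * (8 * (1 + T ^+ 4)) * `|q|)).
    by rewrite ler_wpM2r// (le_trans (YX 4))// ler_wpM2l ?exprn_ge0.
  rewrite (_ : _ * _ * `|q| = X ^+ 4 * (8 * (`|q| + T ^+ 4 * `|q|))); last by ring.
  rewrite (_ : 16 * _ = X ^+ 4 * (16 * (C * X ^+ 3))); last by ring.
  by rewrite ler_wpM2l ?exprn_ge0//; have := CX 3; lra.
have f1 : Y ^+ 3 * `|q1| <= 12 * (C * X ^+ 6).
  apply: (@le_trans _ _ (X ^+ 3 * (4 * (1 + T ^+ 3)) * `|q1|)).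
    by rewrite ler_wpM2r// (le_trans (YX 3))// ler_wpM2l ?exprn_ge0.
  rewrite (_ : _ * _ * `|q1| = X ^+ 3 * (4 * (`|q1| + T ^+ 3 * `|q1|))); last by ring.
  rewrite (_ : 12 * _ = X ^+ 3 * (12 * (C * X ^+ 3))); last by ring.
  by rewrite ler_wpM2l ?exprn_ge0//; have := CX 3; lra.
have f2 : Y ^+ 2 * `|q2| <= 12 * (C * X ^+ 5).
  apply: (@le_trans _ _ (X ^+ 2 * (2 * (1 + T ^+ 2)) * `|q2|)).
    by rewrite ler_wpM2r// (le_trans (YX 2))// ler_wpM2l ?exprn_ge0.
  rewrite (_ : _ * _ * `|q2| = X ^+ 2 * (2 * (`|q2| + T ^+ 2 * `|q2|))); last by ring.
  rewrite (_ : 12 * _ = X ^+ 2 * (12 * (C * X ^+ 3))); last by ring.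
  by rewrite ler_wpM2l ?exprn_ge0//; have := CX 3; lra.
have -> : (`|q2| + 2 * Y * `|q1| + Y ^+ 2 * `|q|) * Y ^+ 2 =
  Y ^+ 2 * `|q2| + 2 * (Y ^+ 3 * `|q1|) + Y ^+ 4 * `|q| by ring.
have := XX 5 7 isT; have := XX 6 7 isT; lra.
Qed.

End division.

(** * Uniform convergence for smooth compactly supported functions *)

Section uniform.
Context {R : realType}.
Local Notation h := (@hermite_fun R).
Implicit Types (x y : R) (f g : R -> R).

Lemma der_unique f x a b :
  is_derive x (1:R) f a -> is_derive x (1:R) f b -> a = b.
Proof. by case=> _ <- [_ <-]. Qed.

(** Here the dependence on [x] of the constant is made explicit: it is what lets
    [x] range over an interval growing with [n]. *)
Lemma hermite_sum_vanishing_le g g1 g2 g3 g4 (C : R) x n :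
  (forall y, is_derive y (1:R) g (g1 y)) ->
  (forall y, is_derive y (1:R) g1 (g2 y)) ->
  (forall y, is_derive y (1:R) g2 (g3 y)) ->
  (forall y, is_derive y (1:R) g3 (g4 y)) ->
  (forall y, (1 + `|y|) ^+ 3 * `|g y| <= C) ->
  (forall y, (1 + `|y|) ^+ 3 * `|g1 y| <= C) ->
  (forall y, (1 + `|y|) ^+ 3 * `|g2 y| <= C) ->
  (forall y, (1 + `|y|) ^+ 3 * `|g3 y| <= C) ->
  (forall y, (1 + `|y|) ^+ 3 * `|g4 y| <= C) ->
  g x = 0 -> x ^+ 2 <= n.+2%:R ->
  `|hermite_sum n.+2 g x| <=
    52 * C * (1 + `|x|) ^+ 7 * ((pi + 1) / 2) * 4 / Num.sqrt n.+2%:R.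
Proof.
move=> d0 d1 d2 d3 b0 b1 b2 b3 b4 gx xn.
have C0 : 0 <= C.
  by apply: le_trans (b0 0); rewrite mulr_ge0// exprn_ge0// one_abs_ge0.
have bnd (k : R -> R) : (forall y, (1 + `|y|) ^+ 3 * `|k y| <= C) -> forall y, `|k y| <= C.
  by move=> bk y; apply: le_trans (bk y); rewrite ler_peMl// exprn_ege1// one_abs_ge1.
have c1 := der_continuous d1; have c2 := der_continuous d2.
have c3 := der_continuous d3.
pose q := quotient_der 0 g1 x; pose q1 := quotient_der 1 g2 x.
pose q2 := quotient_der 2 g3 x.
have dq y : is_derive y (1:R) q (q1 y) := is_derive_quotient_der 0 x y d1 (bnd _ b2).
have dq1 y : is_derive y (1:R) q1 (q2 y) := is_derive_quotient_der 1 x y d2 (bnd _ b3).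
have dq2 y : is_derive y (1:R) q2 (quotient_der 3 g4 x y) :=
  is_derive_quotient_der 2 x y d3 (bnd _ b4).
have qC y : `|q y| <= C := quotient_der_le 0 x y c1 (bnd _ b1).
have q1C y : `|q1 y| <= C := quotient_der_le 1 x y c2 (bnd _ b2).
have q2C y : `|q2 y| <= C := quotient_der_le 2 x y c3 (bnd _ b3).
have Eg : g = (fun y => (y - x) * q y).
  by apply/funext => y; rewrite (quotient_derM x y d0 c1) gx subr0.
have dt y : is_derive y (1:R) (fun y => y - x) (1 : R).
  by apply: (is_derive_eq (der_B (der_id y) (der_cst x y))); rewrite subr0.
have Eg1 y : g1 y = q y + (y - x) * q1 y.
  apply: der_unique (d0 y) _; rewrite Eg.
  by apply: (is_derive_eq (der_M (dt y) (dq y))); rewrite mul1r.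
have Eg2 y : g2 y = 2 * q1 y + (y - x) * q2 y.
  apply: der_unique (d1 y) _.
  rewrite (_ : g1 = (fun y => q y + (y - x) * q1 y)); last exact/funext.
  apply: (is_derive_eq (der_D (dq y) (der_M (dt y) (dq1 y)))); by ring.
rewrite Eg; apply: (hermite_sum_division_le dq dq1 _ _ _ _ _ _ xn).
- exact: der_continuous dq2.
- exact: tempered_bounded (der_continuous dq) qC.
- exact: tempered_bounded (der_continuous dq1) q1C.
- exact: tempered_bounded (der_continuous dq2) q2C.
- by rewrite !mulr_ge0// exprn_ge0// one_abs_ge0.
move=> y; set X := 1 + `|x|; pose Y := 1 + `|y|.
have X1 : 1 <= X := one_abs_ge1 x; have Y1 : 1 <= Y := one_abs_ge1 y.
have Y0 : 0 <= Y := one_abs_ge0 y.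
have yY : `|y| <= Y by rewrite lerDr.
have WY : 1 + y ^+ 2 <= Y ^+ 2.
  rewrite -(real_normK (num_real y)) /Y; have := normr_ge0 y.
  by move: `|y| => u u0; nra.
apply: le_trans (@quotient_weight_le _ C X Y (y - x) (q y) (q1 y) (q2 y)
  C0 X1 Y1 _ _ (qC y) (q1C y) (q2C y) _ _ _).
- apply: ler_pM => //.
  rewrite (le_trans (ler_normD _ _))// lerD//.
    rewrite (le_trans (ler_normD _ _))// lerD2l !normrM (ger0_norm (ler0n _ 2)).
    by rewrite ler_wpM2r// ler_wpM2l.
  by rewrite normrM ger0_norm ?ler_wpM2r// addr_ge0// sqr_ge0.
- rewrite (le_trans (ler_normB _ _))// /X /Y.
  by have := normr_ge0 x; have := normr_ge0 y; move: `|x| `|y| => u v; nra.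
- have : `|y| <= `|x| + `|y - x| by rewrite -[X in `|X| <= _](subrK x) addrC ler_normD.
  rewrite /X /Y; have := normr_ge0 x; have := normr_ge0 (y - x).
  by move: `|x| `|y| `|y - x| => u v w; nra.
- by have := b0 y; rewrite [in g y]Eg.
- by have := b1 y; rewrite Eg1.
- by have := b2 y; rewrite Eg2.
Qed.

Definition rapid0 g := exists C : R, forall y, (1 + `|y|) ^+ 3 * `|g y| <= C.

(** The cubic weight is the one needed to bound [(1 + y ^ 2) (d/dy + y) ^ 2 q]
    for the difference quotient [q]. *)
Fixpoint rapid (m : nat) g : Prop := rapid0 g /\
  match m with
  | 0 => True
  | m'.+1 => exists2 g', forall y, is_derive y (1:R) g (g' y) & rapid m' g'
  end.

Lemma rapid0_comb a f b g : rapid0 f -> rapid0 g ->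
  rapid0 (fun y => a * f y + b * g y).
Proof.
move=> [C fC] [D gD]; exists (`|a| * C + `|b| * D) => y.
rewrite (le_trans (ler_wpM2l _ (ler_normD _ _))) ?exprn_ge0 ?one_abs_ge0//.
by rewrite mulrDr !normrM lerD// mulrCA ler_wpM2l.
Qed.

Lemma rapid_comb m a f b g : rapid m f -> rapid m g ->
  rapid m (fun y => a * f y + b * g y).
Proof.
elim: m f g => [|m IH] f g [f0 f1] [g0 g1]; split => //; try exact: rapid0_comb.
move: f1 g1 => [f' df rf] [g' dg rg].
exists (fun y => a * f' y + b * g' y); last exact: IH.
by move=> y; exact: der_D (der_Z a (df y)) (der_Z b (dg y)).
Qed.

Lemma rapid_hermite m n : rapid m (h n).
Proof.
elim: m n => [|m IH] n; (split; first exact: hermite_decayX) => //.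
exists (fun y => ladder n / 2 * h n.-1 y + - (ladder n.+1 / 2) * h n.+1 y).
  move=> y; apply: (is_derive_eq (hermite_fun_lower n y)).
  have := hermite_fun_mulX n y.
  by move: (h n y) (h n.-1 y) (h n.+1 y) => u v w ->; field.
by apply: rapid_comb; exact: IH.
Qed.

Lemma compactly_supported_derive1n g : compactly_supported g ->
  exists2 M : R, 0 <= M & forall i x, M < `|x| -> derive1n i g x = 0.
Proof.
move=> cg; have [M0 [_ hM]] := compact_bounded cg.
exists (`|M0| + 1); first by rewrite addr_ge0.
have g0 x : `|M0| + 1 < `|x| -> g x = 0.
  move=> xM; apply/eqP/negPn/negP => gx.
  have := hM (`|M0| + 1); rewrite (le_lt_trans (ler_norm _)) ?ltrDl// => /(_ isT x).
  have xA : closure [set x | g x != 0] x by apply: subset_closure.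
  by move=> /(_ xA) /=; rewrite leNgt xM.
elim=> [|i IH] x xM; first exact: g0.
rewrite derive1nS derive1E.
rewrite (@near_eq_derive _ _ _ _ (cst 0)); first by rewrite derive_cst.
have : open (fun y : R => `|M0| + 1 < `|y|).
  apply: (@open_comp _ _ (@Num.norm _ R) (fun z : R => `|M0| + 1 < z)).
    by move=> y _; exact: norm_continuous.
  exact: open_gt.
by move=> /(_ _ xM); apply: filterS => y; exact: IH.
Qed.

Lemma smooth_rapid g m i : smooth g -> compactly_supported g ->
  rapid m (derive1n i g).
Proof.
move=> sg cg; have [M M0 hM] := compactly_supported_derive1n cg.
have dg k y : is_derive y (1:R) (derive1n k g) (derive1n k.+1 g y).
  by rewrite derive1nS; apply: DeriveDef; [exact: sg|rewrite derive1E].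
have r0 k : rapid0 (derive1n k g).
  pose F y := (1 + `|y|) ^+ 3 * `|derive1n k g y|.
  have cF : continuous F.
    move=> y; apply: cvgM.
      have c1 : {for y, continuous (fun y : R => 1 + `|y|)}.
        by apply: cvgD; [exact: cvg_cst|exact: norm_continuous].
      exact: (continuous_comp c1 (@exprn_continuous R 3 _)).
    exact: (continuous_comp (der_continuous (dg k) (x := y)) (@norm_continuous R R _)).
  have [|c _ cM] := @EVT_max _ F (- M) M _ (continuous_subspaceT cF).
    by rewrite ge0_cp.
  exists (F c) => y; have [yM|yM] := leP `|y| M.
    by apply: cM; rewrite in_itv/= -ler_norml.
  by rewrite hM// normr0 mulr0 /F mulr_ge0// exprn_ge0// one_abs_ge0.
elim: m i => [|m IH] i; (split; first exact: r0) => //.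
by exists (derive1n i.+1 g); [exact: dg|exact: IH].
Qed.

(** With [a = f x / h_0 x], the function [f - a h_0] vanishes at [x], while
    [h_0] is reproduced by its Hermite sums. *)
Lemma hermite_sum_uniform f : smooth f -> compactly_supported f ->
  exists2 K : R, 0 <= K & forall n x, x ^+ 2 <= n.+2%:R ->
    `|hermite_sum n.+2 f x - f x| <= K * (1 + `|x|) ^+ 7 / Num.sqrt n.+2%:R.
Proof.
move=> sf cf; have [M M0 hM] := compactly_supported_derive1n cf.
have [[C0 f0] [f1 e1 [[C1 fb1]
  [f2 e2 [[C2 fb2] [f3 e3 [[C3 fb3] [f4 e4 [[C4 fb4] _]]]]]]]]]
  := smooth_rapid 4 0 sf cf.
have [[D0 g0] [g1 d1 [[D1 gb1]
  [g2 d2 [[D2 gb2] [g3 d3 [[D3 gb3] [g4 d4 [[D4 gb4] _]]]]]]]]]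
  := rapid_hermite 4 0.
have /andP[gam0 gam1] := @hermite_gamma0_itv R.
have h0 x : 0 < h 0 x by rewrite hermite_fun0 mulr_gt0// expR_gt0.
have c0 : 0 <= C0.
  by apply: le_trans (f0 0); rewrite mulr_ge0// exprn_ge0// one_abs_ge0.
(* [f] vanishes off [[- M, M]], where [h_0] is at least its value at [M] *)
pose A := C0 / (hermite_gamma R 0 * expR (- (M ^+ 2 / 2))).
have A0 : 0 <= A by rewrite divr_ge0// mulr_ge0 ?expR_ge0// ltW.
have fA x : `|f x / h 0 x| <= A.
  rewrite normf_div (gtr0_norm (h0 x)).
  have [xM|xM] := leP `|x| M; last first.
    by rewrite [f x](hM 0%N)// normr0 mul0r.
  have -> : A = C0 * (hermite_gamma R 0 * expR (- (M ^+ 2 / 2)))^-1 by [].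
  apply: ler_pM => //; first by rewrite invr_ge0 ltW.
    by apply: le_trans (f0 x); rewrite ler_peMl// exprn_ege1// one_abs_ge1.
  have := h0 x; rewrite hermite_fun0 => hx0.
  rewrite lef_pV2 ?posrE ?(mulr_gt0 gam0 (expR_gt0 _))//.
  apply: ler_wpM2l; first exact: ltW.
  rewrite ler_expR lerN2 ler_wpM2r// -(real_normK (num_real x)).
  by rewrite lerXn2r ?nnegrE.
pose C := `|C0| + `|C1| + `|C2| + `|C3| + `|C4|
  + A * (`|D0| + `|D1| + `|D2| + `|D3| + `|D4|).
have CC : 0 <= C by apply: addr_ge0; [|apply: mulr_ge0 => //]; rewrite !addr_ge0.
exists (52 * C * ((pi + 1) / 2) * 4).
  have pi1 : 0 <= (pi + 1) / 2 :> R by rewrite divr_ge0// addr_ge0// pi_ge0.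
  by do 3 (apply: mulr_ge0 => //).
move=> n x xn; set a := f x / h 0 x.
have bd (u v : R -> R) (c d : R) : (forall y, (1 + `|y|) ^+ 3 * `|u y| <= c) ->
    (forall y, (1 + `|y|) ^+ 3 * `|v y| <= d) -> `|c| + A * `|d| <= C ->
    forall y, (1 + `|y|) ^+ 3 * `|u y - a * v y| <= C.
  move=> uc vd cdC y; apply: le_trans cdC.
  rewrite (le_trans (ler_wpM2l _ (ler_normB _ _))) ?exprn_ge0 ?one_abs_ge0//.
  rewrite mulrDr lerD ?(le_trans (uc y)) ?ler_norm//.
  rewrite normrM mulrCA; apply: ler_pM => //.
  - exact: fA.
  - by rewrite (le_trans (vd y))// ler_norm.
have nn (z : R) : 0 <= `|z| by [].
have AD (z : R) : 0 <= A * `|z| by rewrite mulr_ge0.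
have tf : tempered f.
  apply: (tempered_bounded (C := C0) (der_continuous e1)) => y.
  by apply: le_trans (f0 y); rewrite ler_peMl// exprn_ege1// one_abs_ge1.
have th := tempered_hermite 0 (R := R).
have tah := tempered_M (tempered_cst a) th.
have SE : hermite_sum n.+2 f x - f x =
    hermite_sum n.+2 (fun y => f y - a * h 0 y) x.
  have -> : f x = a * h 0 x by rewrite /a divfK// gt_eqF.
  rewrite -(hermite_sum_fun0 n.+2 x) /hermite_sum mulr_sumr -sumrB.
  apply: eq_bigr => k _; rewrite hermite_coefB// hermite_coefZ// mulrBl.
  by rewrite mulrA.
rewrite SE.
have -> : 52 * C * ((pi + 1) / 2) * 4 * (1 + `|x|) ^+ 7 =
  52 * C * (1 + `|x|) ^+ 7 * ((pi + 1) / 2) * 4 by ring.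
have db (u u' v v' : R -> R) : (forall y, is_derive y (1:R) u (u' y)) ->
    (forall y, is_derive y (1:R) v (v' y)) ->
    forall y, is_derive y (1:R) (fun y => u y - a * v y) (u' y - a * v' y).
  by move=> du dv y; exact: der_B (du y) (der_Z a (dv y)).
apply: (hermite_sum_vanishing_le (db _ _ _ _ e1 d1) (db _ _ _ _ e2 d2)
  (db _ _ _ _ e3 d3) (db _ _ _ _ e4 d4) (bd _ _ _ _ f0 g0 _) (bd _ _ _ _ fb1 gb1 _)
  (bd _ _ _ _ fb2 gb2 _) (bd _ _ _ _ fb3 gb3 _) (bd _ _ _ _ fb4 gb4 _)) => //.
all: rewrite /C ?mulrDr.
all: try by move: (nn C0) (nn C1) (nn C2) (nn C3) (nn C4)
  (AD D0) (AD D1) (AD D2) (AD D3) (AD D4); lra.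
by rewrite /a divfK ?subrr// gt_eqF.
Qed.

End uniform.

(** * Smooth functions with compact support *)

Section smooth_functions.
Context {R : realType}.
Implicit Types (f g : R -> R) (x t : R).

(** Differentiability of order [n], as a class visibly stable under products
    and quotients. *)
Fixpoint times_diff (n : nat) g : Prop :=
  if n is n'.+1
  then exists2 g', forall x, is_derive x (1:R) g (g' x) & times_diff n' g'
  else True.

Lemma times_diffW n g : times_diff n.+1 g -> times_diff n g.
Proof.
by elim: n g => // n IH g [g' dg Cg']; exists g' => //; exact: IH.
Qed.

Lemma times_diff_cst n c : times_diff n (fun=> c).
Proof.
elim: n c => // n IH c; exists (fun=> 0); last exact: IH.
by move=> x; exact: der_cst.
Qed.

Lemma times_diffD n f g : times_diff n f -> times_diff n g ->
  times_diff n (fun x => f x + g x).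
Proof.
elim: n f g => // n IH f g [f' df Cf] [g' dg Cg].
exists (fun x => f' x + g' x); last exact: IH.
by move=> x; exact: der_D.
Qed.

Lemma times_diffM n f g : times_diff n f -> times_diff n g ->
  times_diff n (fun x => f x * g x).
Proof.
elim: n f g => // n IH f g Cf Cg.
have Cf0 := times_diffW Cf; have Cg0 := times_diffW Cg.
move: Cf Cg => [f' df Cf] [g' dg Cg].
exists (fun x => f' x * g x + f x * g' x); last by apply: times_diffD; exact: IH.
by move=> x; exact: der_M.
Qed.

Lemma times_diffV n g : (forall x, g x != 0) -> times_diff n g ->
  times_diff n (fun x => (g x)^-1).
Proof.
move=> g0; elim: n => // n IH Cg; have Cg0 := times_diffW Cg.
move: Cg => [g' dg Cg]; exists (fun x => (- 1) * (g' x * ((g x)^-1 * (g x)^-1))).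
  move=> x; apply: (is_derive_eq (is_deriveV (g0 x) (dg x))).
  by rewrite /GRing.scale/= -exprVn expr2; ring.
apply: times_diffM; first exact: times_diff_cst.
by do 2 (apply: times_diffM => //); exact: IH.
Qed.

Lemma times_diff_affine n g (a b : R) : times_diff n g ->
  times_diff n (fun x => g (a * x + b)).
Proof.
elim: n g => // n IH g [g' dg Cg]; exists (fun x => a * g' (a * x + b)).
  move=> x; have d1 : is_derive x (1:R) (fun x => a * x + b) a.
    apply: (is_derive_eq (der_D (der_Z a (der_id x)) (der_cst b x))).
    by rewrite mulr1 addr0.
  by apply: (is_derive_eq (der_comp (g := fun x => a * x + b) (dg _) d1)); ring.
by apply: times_diffM; [exact: times_diff_cst|exact: IH].
Qed.

Lemma times_diff_smooth g : (forall n, times_diff n g) -> smooth g.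
Proof.
move=> Cg n x; have := Cg n.+1; elim: n {Cg} g => [|n IH] g [g' dg Cg].
  by rewrite derive1n0; case: (dg x).
by rewrite derive1Sn (der_derive1 dg); exact: IH.
Qed.

(** Used for the flat function below, whose difference quotients at the origin
    are not given by a formula. *)
Lemma is_derive_at0 f (C : R) : (forall x, `|f x| <= C * x ^+ 2) ->
  is_derive (0 : R) (1:R) f 0.
Proof.
move=> fC; have f0 : f 0 = 0.
  by apply/eqP; rewrite -normr_le0 (le_trans (fC 0))// expr0n mulr0.
have C0 : 0 <= C by have := fC 1; rewrite expr1n mulr1; apply: le_trans.
have L : h^-1 *: (f (h *: (1:R) + 0) - f 0) @[h --> (0:R)^'] --> (0:R).
  apply: norm_cvg0; apply: (@squeeze_cvgr _ _ _ _ (fun=> 0) (fun h => C * `|h|)).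
  - near=> h; rewrite normr_ge0/= f0 subr0 addr0 /GRing.scale/= mulr1.
    have h0 : h != 0 by near: h; exact: nbhs_dnbhs_neq.
    rewrite normrM normfV ler_pdivrMl ?normr_gt0// (le_trans (fC h))//.
    by rewrite -(real_normK (num_real h)) expr2 mulrCA.
  - exact: cvg_cst.
  - rewrite -[X in _ --> X](mulr0 C); apply: cvgMr.
    rewrite -[X in _ --> X](normr0 R); apply: cvg_norm.
    by apply: cvg_within_filter; exact: cvg_id.
split; first by apply/cvg_ex; exists 0.
exact: cvg_lim L.
Unshelve. all: by end_near. Qed.

(** [flat 0] is the classical smooth function [exp (- 1 / t)] vanishing for
    [t <= 0]; the powers of [1 / t] make the family stable under derivation. *)
Definition flat k t : R := if 0 < t then t^-1 ^+ k * expR (- t^-1) else 0.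

Lemma powX_expRN_le k (u : R) : 0 <= u -> u ^+ k * expR (- u) <= k.+1%:R ^+ k.+1.
Proof.
move=> u0; rewrite expRN ler_pdivrMr ?expR_gt0//.
have K0 : 0 < k.+1%:R :> R by [].
have -> : expR u = expR (u / k.+1%:R) ^+ k.+1.
  by rewrite -expRM_natl; congr expR; rewrite mulrC divfK// gt_eqF.
rewrite -exprMn; apply: (@le_trans _ _ ((1 + u) ^+ k.+1)).
  apply: (@le_trans _ _ ((1 + u) ^+ k)).
    by rewrite lerXn2r ?nnegrE ?addr_ge0// lerDr.
  by rewrite ler_weXn2l// lerDl.
rewrite lerXn2r ?nnegrE ?addr_ge0 ?mulr_ge0 ?expR_ge0//.
rewrite (le_trans _ (ler_wpM2l (ltW K0) (expR_ge1Dx _)))//.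
by rewrite mulrDr mulr1 mulrCA mulfV ?gt_eqF// mulr1 lerD2r ler1n.
Qed.

Lemma flat_sqr_le k t : `|flat k t| <= k.+3%:R ^+ k.+3 * t ^+ 2.
Proof.
rewrite /flat; case: ifPn => [t0|_]; last by rewrite normr0 mulr_ge0 ?sqr_ge0 ?exprn_ge0.
rewrite ger0_norm ?mulr_ge0 ?exprn_ge0 ?invr_ge0 ?(ltW t0) ?expR_ge0//.
rewrite -ler_pdivrMr ?exprn_gt0//.
apply: le_trans (@powX_expRN_le k.+2 t^-1 _); last by rewrite invr_ge0 ltW.
by rewrite -[in leRHS]addn2 exprD mulrAC -exprVn.
Qed.

Lemma is_derive_flat k t :
  is_derive t (1:R) (flat k) (flat k.+2 t + - k%:R * flat k.+1 t).
Proof.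
have [t0|t0|<-] := ltgtP 0 t; last first.
- rewrite /flat ltxx mulr0 addr0; exact: is_derive_at0 (flat_sqr_le k).
- have <- : 0 = flat k.+2 t + - k%:R * flat k.+1 t.
    by rewrite /flat !ltNge (ltW t0)/= mulr0 addr0.
  apply: near_eq_is_derive (der_cst 0 t).
  near=> s; rewrite /flat ltNge (_ : s <= 0)//; apply: ltW.
  by near: s; exact: (cvgr_lt t).
- have du : is_derive t (1:R) (fun s => s^-1) (- t^-1 ^+ 2).
    apply: (is_derive_eq (is_deriveV (lt0r_neq0 t0) (der_id t))).
    by rewrite /GRing.scale/= mulr1 exprVn.
  have d1 : is_derive t (1:R) (fun s => expR (- s^-1)) (expR (- t^-1) * t^-1 ^+ 2).
    have dn := is_deriveN du.
    apply: (is_derive_eq (der_comp (g := fun s => - s^-1) (is_derive_expR _) dn)).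
    by rewrite opprK.
  have d2 : is_derive t (1:R) (fun s => s^-1 ^+ k) (k%:R * t^-1 ^+ k.-1 * - t^-1 ^+ 2).
    elim: k => [|k IH].
      by apply: (is_derive_eq (der_cst (1 : R) t)); rewrite !mul0r.
    have := der_M du IH; rewrite (_ : (fun s => _) = fun s => s^-1 ^+ k.+1).
      move=> d2; apply: (is_derive_eq d2); rewrite -natr1.
      by case: (k) => [|j]; rewrite /= ?exprS; ring.
    by apply/funext => s; rewrite exprS.
  have d3 := der_M d2 d1.
  have E : flat k.+2 t + - k%:R * flat k.+1 t =
      (k%:R * t^-1 ^+ k.-1 * - t^-1 ^+ 2) * expR (- t^-1) +
      t^-1 ^+ k * (expR (- t^-1) * t^-1 ^+ 2).
    rewrite /flat t0; case: k {d2 d3} => [|k] /=; rewrite !exprS; ring.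
  rewrite E; apply: near_eq_is_derive d3; near=> s.
  rewrite /flat (_ : 0 < s)//; by near: s; exact: (cvgr_gt t).
Unshelve. all: by end_near. Qed.

Lemma times_diff_flat n k : times_diff n (flat k).
Proof.
elim: n k => // n IH k.
exists (fun t => flat k.+2 t + - k%:R * flat k.+1 t).
  exact: is_derive_flat.
apply: times_diffD => //; apply: times_diffM => //; exact: times_diff_cst.
Qed.

Definition bump (a b x : R) : R := flat 0 (x - a) * flat 0 (b - x).

Lemma flat0_gt0 t : 0 < t -> 0 < flat 0 t.
Proof. by move=> t0; rewrite /flat t0 expr0 mul1r expR_gt0. Qed.

Lemma flat0_eq0 t : t <= 0 -> flat 0 t = 0.
Proof. by move=> t0; rewrite /flat ltNge t0. Qed.

Lemma flat0_ge0 t : 0 <= flat 0 t.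
Proof. by have [/flat0_eq0 ->//|/flat0_gt0/ltW] := leP t 0. Qed.

Lemma bump_ge0 a b x : 0 <= bump a b x.
Proof. by rewrite mulr_ge0 ?flat0_ge0. Qed.

Lemma bump_gt0 a b x : a < x < b -> 0 < bump a b x.
Proof. by move=> /andP[ax xb]; rewrite mulr_gt0 ?flat0_gt0 ?subr_gt0. Qed.

Lemma bump_eq0 a b x : ~~ (a < x < b) -> bump a b x = 0.
Proof.
rewrite negb_and -!leNgt => /orP[xa|bx].
  by rewrite /bump flat0_eq0 ?subr_le0// mul0r.
by rewrite /bump [flat 0 (b - x)]flat0_eq0 ?subr_le0// mulr0.
Qed.

Lemma times_diff_bump n a b : times_diff n (bump a b).
Proof.
have C0 := times_diff_flat n 0; rewrite /bump.
apply: times_diffM.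
  rewrite (_ : (fun x => _) = (fun x => flat 0 (1 * x + - a))).
    exact: times_diff_affine.
  by apply/funext => x; rewrite mul1r.
rewrite (_ : (fun x => _) = (fun x => flat 0 ((-1) * x + b))).
  exact: times_diff_affine.
by apply/funext => x; rewrite mulN1r addrC.
Qed.

(** Smooth functions increasing to the indicator of [`]a, b[]. *)
Definition plateau (a b : R) (n : nat) (x : R) : R :=
  bump a b x / (bump a b x + n.+1%:R^-1).

Lemma plateau_itv a b n x : 0 <= plateau a b n x <= 1.
Proof.
have b0 := bump_ge0 a b x; have n0 : 0 < n.+1%:R^-1 :> R by rewrite invr_gt0.
have s0 : 0 < bump a b x + n.+1%:R^-1 by rewrite ltr_wpDl.
by rewrite divr_ge0 ?(ltW s0)//= ler_pdivrMr// mul1r lerDl ltW.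
Qed.

Lemma plateau_eq0 a b n x : ~~ (a < x < b) -> plateau a b n x = 0.
Proof. by move=> /bump_eq0; rewrite /plateau => ->; rewrite mul0r. Qed.

Lemma cvg_plateau a b x :
  plateau a b n x @[n --> \oo] --> (\1_(`]a, b[ : set R) x : R).
Proof.
rewrite indicE; have [xab|xab] := boolP (x \in (`]a, b[ : set R)%classic).
  have b0 : 0 < bump a b x by apply: bump_gt0; move: xab; rewrite inE/= in_itv.
  rewrite [X in _ --> X](_ : _ = bump a b x * (bump a b x + 0)^-1); last first.
    by rewrite addr0 mulfV// gt_eqF.
  apply: cvgMr; apply: cvgV; first by rewrite addr0 gt_eqF.
  by apply: cvgD; [exact: cvg_cst|exact: cvg_harmonic].
rewrite (_ : (fun n => _) = (fun=> 0)); first exact: cvg_cst.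
apply/funext => n; apply: plateau_eq0; move: xab; apply: contra => xab.
by rewrite inE/= in_itv.
Qed.

Lemma times_diff_plateau k a b n : times_diff k (plateau a b n).
Proof.
apply: times_diffM; first exact: times_diff_bump.
apply: times_diffV.
  by move=> x; rewrite gt_eqF// ltr_wpDl ?bump_ge0// invr_gt0.
by apply: times_diffD; [exact: times_diff_bump|exact: times_diff_cst].
Qed.

(** Compactness of the support is kept as a bound, which is easier to propagate. *)
Definition test_function g :=
  (forall n, times_diff n g) /\ exists M : R, forall x, M < `|x| -> g x = 0.

Lemma test_function_smooth g : test_function g -> smooth g.
Proof. by move=> [Cg _]; exact: times_diff_smooth. Qed.

Lemma test_function_compactly_supported g :
  test_function g -> compactly_supported g.
Proof.
move=> [_ [M gM]]; apply: (@subclosed_compact _ _ (`[- M, M]%classic : set R)).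
- exact: closed_closure.
- exact: segment_compact.
- rewrite [X in _ `<=` X](closure_id _).1; last exact: interval_closed.
  apply: closure_subset => x /= gx.
  rewrite in_itv/= -ler_norml leNgt; apply/negP => /gM g0.
  by rewrite g0 eqxx in gx.
Qed.

Lemma test_function_comb a f b g : test_function f -> test_function g ->
  test_function (fun x => a * f x + b * g x).
Proof.
move=> [Cf [M fM]] [Cg [N gN]]; split.
  by move=> n; apply: times_diffD; apply: times_diffM => //; exact: times_diff_cst.
exists (Num.max M N) => x; rewrite gt_max => /andP[Mx Nx].
by rewrite fM// gN// !mulr0 addr0.
Qed.

Lemma test_function_plateau a b n : test_function (plateau a b n).
Proof.
split; first by move=> k; exact: times_diff_plateau.
exists (Num.max `|a| `|b|) => x; rewrite gt_max => /andP[ax bx].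
apply: plateau_eq0; apply/negP => /andP[ax' xb'].
have [x0|x0] := leP 0 x.
  move: bx; rewrite (ger0_norm x0) ltNge => /negP; apply.
  by rewrite (le_trans (ltW xb'))// ler_norm.
move: ax; rewrite (ltr0_norm x0) ltNge => /negP; apply.
by rewrite (@le_trans _ _ (- a))// ?lerN2 ?(ltW ax')// -normrN ler_norm.
Qed.

Lemma test_function_continuous g : test_function g -> continuous g.
Proof. by move=> [/(_ 1%N)[g' dg _] _]; exact: der_continuous dg. Qed.

End smooth_functions.

(** * Modulars and modular approximation *)

Section modular.
Context {R : realType}.
Notation cm := (@completed_lebesgue_measure R).
Implicit Types (p u v w f g h : R -> R) (c : R).

Definition young_real p := [/\ p 0 = 0, {homo p : s t / s <= t}
  & forall l t, 0 <= l <= 1 -> 0 <= t -> p (l * t) <= l * p t].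

(** A finite Young function is used below only through a nondecreasing real
    function lying under its chords from the origin. *)
Lemma young_realP (P : R -> \bar R) : young_function P ->
  (forall t, 0 <= t -> (P t < +oo)%E) ->
  exists2 p, young_real p & forall t, 0 <= t -> P t = (p t)%:E.
Proof.
move=> [P0 Pge0 _ Pconv _] Pfin.
pose p t := fine (P (Num.max t 0)).
have pE t : 0 <= t -> P t = (p t)%:E.
  by move=> t0; rewrite /p max_l// fineK// ge0_fin_numE ?Pfin// Pge0.
exists p => //; have p0 : p 0 = 0 by rewrite /p maxxx P0.
have pge0 t : 0 <= p t by rewrite fine_ge0// Pge0// le_max lexx orbT.
have psc l t : 0 <= l <= 1 -> 0 <= t -> p (l * t) <= l * p t.
  move=> l01 t0; have /andP[l0 l1] := l01.
  have := Pconv t 0 l t0 (lexx _) l01; rewrite mulr0 addr0 P0 mule0 adde0.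
  by rewrite !pE ?mulr_ge0// -EFinM lee_fin.
split => // s t st; have [s0|s0] := leP s 0.
  by rewrite [p s](_ : _ = 0)//; rewrite /p max_r// P0.
have t0 : 0 < t := lt_le_trans s0 st.
have st1 : 0 <= s / t <= 1.
  by rewrite divr_ge0 ?(ltW s0) ?(ltW t0)//= ler_pdivrMr// mul1r.
have := psc _ _ st1 (ltW t0); rewrite divfK ?gt_eqF// => /le_trans; apply.
by rewrite ler_piMl//; case/andP: st1.
Qed.

Definition modular p c u : \bar R := (\int[cm]_x (p (c * `|u x|))%:E)%E.

Section fixed_p.
Variable p : R -> R.
Hypothesis yp : young_real p.

Lemma young_real_ge0 t : 0 <= t -> 0 <= p t.
Proof. by move=> t0; case: yp => p0 ph _; rewrite -p0; exact: ph. Qed.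

Lemma measurable_young_abs c u : measurable_fun [set: completedR R] u ->
  measurable_fun [set: completedR R] (fun x => (p (c * `|u x|))%:E).
Proof.
move=> mu; apply/measurable_EFinP; case: yp => _ ph _.
have mp : measurable_fun [set: R] p by exact: nondecreasing_measurable.
have m1 : measurable_fun [set: completedR R] (fun x => `|u x|).
  exact: (measurableT_comp (@normr_measurable R setT) mu).
have m2 : measurable_fun [set: completedR R] (fun x => c * `|u x|).
  by apply: measurable_funM; [exact: measurable_cst|exact: m1].
exact: (measurableT_comp mp m2).
Qed.

Lemma modular_le c d u v :
  measurable_fun [set: completedR R] u -> measurable_fun [set: completedR R] v ->
  0 <= c -> (forall x, c * `|u x| <= d * `|v x|) ->
  (modular p c u <= modular p d v)%E.
Proof.
move=> mu mv c0 uv; have [_ ph _] := yp.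
apply: (ge0_le_integral cm measurableT _
  (measurable_young_abs c mu) (measurable_young_abs d mv)).
  by move=> x _; rewrite lee_fin; apply: young_real_ge0; exact: mulr_ge0.
by move=> x _; rewrite lee_fin; exact: ph.
Qed.

(** The larger of the two terms on the right is at least half of the left one, so
    monotonicity of [p] is enough. *)
Lemma modular_le_add c (a b : R) u v w : measurable_fun [set: completedR R] u ->
  measurable_fun [set: completedR R] v -> measurable_fun [set: completedR R] w ->
  0 <= c -> 0 <= a -> 0 <= b ->
  (forall x, c * `|u x| <= a * `|v x| + b * `|w x|) ->
  (modular p c u <= modular p (2 * a) v + modular p (2 * b) w)%E.
Proof.
move=> mu mv mw c0 a0 b0 uvw; have [_ ph _] := yp.
have pge0 (k : R) (z : R -> R) x : 0 <= k -> 0 <= p (k * `|z x|).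
  by move=> k0; apply: young_real_ge0; exact: mulr_ge0.
have pgeE (k : R) (z : R -> R) x : 0 <= k -> (0 <= (p (k * `|z x|))%:E)%E.
  by move=> k0; rewrite lee_fin; exact: pge0.
have a2 : 0 <= 2 * a by exact: mulr_ge0.
have b2 : 0 <= 2 * b by exact: mulr_ge0.
have m1 := measurable_young_abs c mu.
have m2 := measurable_young_abs (2 * a) mv.
have m3 := measurable_young_abs (2 * b) mw.
have E := ge0_integralD cm measurableT (fun x _ => pgeE _ v x a2) m2
  (fun x _ => pgeE _ w x b2) m3.
rewrite /modular -E.
apply: (ge0_le_integral cm measurableT (fun x _ => pgeE _ u x c0) m1
  (emeasurable_funD m2 m3)) => x _.
rewrite -EFinD lee_fin (le_trans (ph _ _ (uvw x)))//.
have pv := pge0 _ v x a2; have pw := pge0 _ w x b2.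
have [vw|wv] := leP (a * `|v x|) (b * `|w x|).
  by rewrite (@le_trans _ _ (p (2 * b * `|w x|))) ?lerDr//; apply: ph; lra.
by rewrite (@le_trans _ _ (p (2 * a * `|v x|))) ?lerDl//; apply: ph; lra.
Qed.

(** Membership in the modular closure of the test functions, asked for at every
    scale [c] so that the closure is a vector space. *)
Definition approximable f := measurable_fun [set: completedR R] f /\
  forall c e : R, 0 < c -> 0 < e ->
    exists2 h, test_function h & (modular p c (fun x => f x - h x)%R < e%:E)%E.

Lemma measurable_test_function h :
  test_function h -> measurable_fun [set: completedR R] h.
Proof.
move=> /test_function_continuous ch; apply: measurable_caratheodory.
exact: continuous_measurable_fun.
Qed.

Lemma approximable_test_function h : test_function h -> approximable h.
Proof.
move=> th; split; first exact: measurable_test_function.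
move=> c e c0 e0; exists h => //; rewrite /modular.
under eq_integral => x _ do rewrite subrr normr0 mulr0 (let: And3 p0 _ _ := yp in p0).
by rewrite integral0 lte_fin.
Qed.

Lemma approximable_modular_limit f : measurable_fun [set: completedR R] f ->
  (forall c e : R, 0 < c -> 0 < e ->
    exists2 g, approximable g & (modular p c (fun x => f x - g x)%R < e%:E)%E) ->
  approximable f.
Proof.
move=> mf H; split => // c e c0 e0.
have c2 : 0 < 2 * c by rewrite mulr_gt0.
have e2 : 0 < e / 2 by rewrite divr_gt0.
have [g [mg ag] fg] := H _ _ c2 e2; have [h th gh] := ag _ _ c2 e2.
exists h => //; have mh := measurable_test_function th.
apply: le_lt_trans; first apply: (modular_le_add (u := fun x => f x - h x)
    (v := fun x => f x - g x)
    (w := fun x => g x - h x) (measurable_funB mf mh) (measurable_funB mf mg)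
    (measurable_funB mg mh) (ltW c0) (ltW c0) (ltW c0)) => x.
  rewrite -mulrDr; apply: ler_wpM2l; first exact: ltW.
  have -> : f x - h x = (f x - g x) + (g x - h x) by rewrite addrA subrK.
  exact: ler_normD.
by rewrite (splitr e) EFinD lteD.
Qed.

Lemma approximable_comb a f b g : approximable f -> approximable g ->
  approximable (fun x => a * f x + b * g x).
Proof.
move=> [mf af] [mg ag]; split.
  by apply: measurable_funD; apply: measurable_funM => //; exact: measurable_cst.
move=> c e c0 e0; have e2 : 0 < e / 2 by rewrite divr_gt0.
have pos (z : R) : 0 < c * (`|z| + 1) by rewrite mulr_gt0// ltr_wpDl.
have pos2 (z : R) : 0 < 2 * (c * (`|z| + 1)) by rewrite mulr_gt0.
have [k tk fk] := af _ _ (pos2 a) e2; have [l tl gl] := ag _ _ (pos2 b) e2.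
exists (fun x => a * k x + b * l x); first exact: test_function_comb.
have mk := measurable_test_function tk; have ml := measurable_test_function tl.
have mfg : measurable_fun [set: completedR R] (fun x => a * f x + b * g x).
  by apply: measurable_funD; apply: measurable_funM => //; exact: measurable_cst.
have mkl : measurable_fun [set: completedR R] (fun x => a * k x + b * l x).
  by apply: measurable_funD; apply: measurable_funM => //; exact: measurable_cst.
apply: le_lt_trans; first apply: (modular_le_add
    (u := fun x => a * f x + b * g x - (a * k x + b * l x)) (v := fun x => f x - k x)
    (w := fun x => g x - l x) (measurable_funB mfg mkl) (measurable_funB mf mk)
    (measurable_funB mg ml) (ltW c0) (ltW (pos a)) (ltW (pos b))) => x.
  rewrite -!mulrA -mulrDr; apply: ler_wpM2l; first exact: ltW.
  have -> : a * f x + b * g x - (a * k x + b * l x) =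
      a * (f x - k x) + b * (g x - l x) by move: (f x) (k x) (g x) (l x) => *; ring.
  apply: le_trans (ler_normD _ _) _; rewrite !normrM.
  by apply: lerD; apply: ler_wpM2r => //; rewrite lerDl.
by rewrite (splitr e) EFinD lteD.
Qed.

Lemma approximable0 : approximable (fun=> 0).
Proof.
apply: approximable_test_function; split; first by move=> n; exact: times_diff_cst.
by exists 0.
Qed.

Lemma approximableZ a f : approximable f -> approximable (fun x => a * f x).
Proof.
move=> af; have := approximable_comb a 0 af approximable0.
by congr approximable; apply/funext => x; rewrite mulr0 addr0.
Qed.

Lemma approximableD f g : approximable f -> approximable g ->
  approximable (fun x => f x + g x).
Proof.
move=> af ag; have := approximable_comb 1 1 af ag.
by congr approximable; apply/funext => x; rewrite !mul1r.
Qed.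

Lemma approximableB f g : approximable f -> approximable g ->
  approximable (fun x => f x - g x).
Proof.
move=> af ag; have := approximable_comb 1 (-1) af ag.
by congr approximable; apply/funext => x; rewrite mul1r mulN1r.
Qed.

Lemma approximable_sum (I : Type) (s : seq I) (F : I -> R -> R) :
  (forall i, approximable (F i)) -> approximable (fun x => \sum_(i <- s) F i x).
Proof.
move=> aF; elim: s => [|i s IH].
  have := approximable0; congr approximable.
  by apply/funext => x; rewrite big_nil.
have := approximableD (aF i) IH; congr approximable.
by apply/funext => x; rewrite big_cons.
Qed.

Lemma approximable_ae f g : measurable_fun [set: completedR R] f ->
  approximable g -> ae_eq cm setT f g -> approximable f.
Proof.
move=> mf ag fg; apply: approximable_modular_limit => // c e c0 e0.
exists g; first exact: ag.
have [mg _] := ag; have [p0 _ _] := yp.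
have E0 : modular p c (fun x => f x - g x) = (\int[cm]_x 0)%E.
  apply: (ae_eq_integral _ _ measurableT
    (measurable_young_abs c (measurable_funB mf mg)) (measurable_cst _)).
  apply: filterS fg => x /(_ I) /= -> _.
  by rewrite subrr normr0 mulr0 p0.
by rewrite E0 integral0 lte_fin.
Qed.

Lemma cvg_young_at0 (s : nat -> R) : (forall n, 0 <= s n) ->
  s n @[n --> \oo] --> (0 : R) -> p (s n) @[n --> \oo] --> (0 : R).
Proof.
move=> s0 cs; have [_ _ psc] := yp.
apply: (@squeeze_cvgr _ _ _ _ (fun=> 0) (fun n => s n * p 1)).
- near=> n; rewrite young_real_ge0//=.
  rewrite -[in leLHS](mulr1 (s n)) psc// s0/=.
  by near: n; apply: (cvgr_le 0).
- exact: cvg_cst.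
- by rewrite -[X in _ --> X](mul0r (p 1)); apply: cvgMl.
Unshelve. all: by end_near. Qed.

(** The modular form of dominated convergence. *)
Lemma approximable_dominated_limit (g : nat -> R -> R) f F :
  (forall n, approximable (g n)) -> measurable_fun [set: completedR R] f ->
  measurable_fun [set: completedR R] F ->
  (forall c, 0 < c -> (modular p c F < +oo)%E) ->
  (forall n x, `|g n x| <= F x) ->
  (forall x, g n x @[n --> \oo] --> f x) -> approximable f.
Proof.
move=> ag mf mF iF gF gf; apply: approximable_modular_limit => // c e c0 e0.
have F0 x : 0 <= F x by apply: le_trans (gF 0%N x).
have fF x : `|f x| <= F x.
  have cn : `|g n x| @[n --> \oo] --> `|f x| by apply: cvg_norm; exact: gf.
  by apply: (cvgr_to_le cn); near=> n; exact: gF.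
have mg n : measurable_fun [set: completedR R] (g n) by case: (ag n).
have mfg n : measurable_fun [set: completedR R] (fun x => f x - g n x).
  by exact: measurable_funB.
have c2 : 0 < 2 * c by rewrite mulr_gt0.
have iF' : cm.-integrable setT (fun x => (p (2 * c * `|F x|))%:E).
  apply/integrableP; split; first exact: measurable_young_abs.
  under eq_integral => x _.
    rewrite gee0_abs ?lee_fin ?young_real_ge0 ?mulr_ge0 ?(ltW c0)//. over.
  exact: iF.
have [_ ph _] := yp.
have L : (\int[cm]_x (p (c * `|f x - g n x|))%:E)%E @[n --> \oo] --> (\int[cm]_x 0)%E.
  apply: (@dominated_cvg _ _ _ cm setT measurableT _ _
    (fun x => (p (2 * c * `|F x|))%:E)).
  - by move=> n; exact: measurable_young_abs.
  - move=> x _; apply: cvg_EFin; first by near=> n.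
    apply: cvg_young_at0; first by move=> n; rewrite mulr_ge0// ltW.
    rewrite -[X in _ --> X](mulr0 c); apply: cvgMr.
    rewrite -[X in _ --> X](normr0 R); apply: cvg_norm.
    by rewrite -[X in _ --> X](subrr (f x)); apply: cvgB; [exact: cvg_cst|exact: gf].
  - by [].
  - exact: iF'.
  - move=> n x _; rewrite /= lee_fin ger0_norm ?young_real_ge0 ?mulr_ge0 ?(ltW c0)//.
    apply: ph; rewrite (ger0_norm (F0 x)).
    rewrite (_ : 2 * c * F x = c * (F x + F x)); last by ring.
    rewrite ler_wpM2l ?(ltW c0)// (le_trans (ler_normB _ _))// lerD//.
have L0 : \forall n \near \oo, (modular p c (fun x => f x - g n x)%R < e%:E)%E.
  move: L; rewrite integral0 => L.
  have /fine_cvgP[fin fc] := L.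
  have := cvgr_lt _ fc _ e0 => H; near=> n.
  have fn : modular p c (fun x => f x - g n x)%R \is a fin_num.
    by near: n; exact: fin.
  rewrite -(fineK fn) lte_fin; near: n; exact: H.
have [n _ hn] := L0; exists (g n) => //.
exact: (hn n (leqnn _)).
Unshelve. all: by end_near. Qed.

End fixed_p.

End modular.

(** * Density of the test functions *)

Import HBSimple HBNNSimple.

Section density.
Context {R : realType}.
Notation cm := (@completed_lebesgue_measure R).
Implicit Types (f g : R -> R) (c : R).
Variable p : R -> R.
Hypothesis yp : young_real p.
Local Notation approximable := (approximable p).

Lemma measurable_indic_completed (E : set R) :
  measurable (E : set (completedR R)) -> measurable_fun [set: completedR R] (\1_E : R -> R).
Proof. by move=> mE; exact: (measurable_indic (T := completedR R)). Qed.

Lemma integral_scaled_indic_itv (k a b : R) : 0 <= k ->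
  (\int[cm]_x (k * \1_(`]a, b[%classic : set R) x)%:E =
   k%:E * lebesgue_measure (`]a, b[%classic : set R))%E.
Proof.
move=> k0; have mI : measurable (`]a, b[%classic : set R) by exact: measurable_itv.
have m1 : measurable_fun [set: R] (\1_(`]a, b[%classic) : R -> R).
  exact: measurable_indic.
have m2 : measurable_fun [set: R] (fun x => (k * \1_(`]a, b[%classic : set R) x)%:E).
  apply/measurable_EFinP; apply: measurable_funM; first exact: measurable_cst.
  exact: m1.
have -> : (\int[cm]_x (k * \1_(`]a, b[%classic : set R) x)%:E =
    \int[lebesgue_measure]_x (k * \1_(`]a, b[%classic : set R) x)%:E)%E.
  exact: (integral_completed measurableT m2).
under eq_integral => x _ do rewrite EFinM.
have m1E : measurable_fun [set: measurableTypeR R]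
    (fun x : measurableTypeR R => (\1_(`]a, b[%classic : set R) x : R)%:E).
  by apply/measurable_EFinP; exact: m1.
have i0 : forall x : measurableTypeR R, [set: measurableTypeR R] x ->
    (0 <= (\1_(`]a, b[%classic : set R) x : R)%:E)%E.
  by move=> x _; rewrite lee_fin indicE.
have k0E : (0 <= k%:E)%E by rewrite lee_fin.
rewrite (ge0_integralZl lebesgue_measure measurableT m1E i0 k0E).
by rewrite integral_indic// setIT.
Qed.

Lemma modular_indic_itv c (a b : R) : 0 < c ->
  (modular p c (\1_(`]a, b[%classic) : R -> R) < +oo)%E.
Proof.
move=> c0; have [p0 _ _] := yp.
have E x : (p (c * `|\1_(`]a, b[%classic) x|))%:E =
    ((p c) * \1_(`]a, b[%classic : set R) x)%:E.
  rewrite indicE; case: (_ \in _) => /=.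
    by rewrite normr1 !mulr1.
  by rewrite normr0 !mulr0 p0.
have -> : modular p c (\1_(`]a, b[%classic) : R -> R) =
    (\int[cm]_x ((p c) * \1_(`]a, b[%classic : set R) x)%:E)%E.
  by apply: eq_integral => x _; exact: E.
rewrite integral_scaled_indic_itv ?(young_real_ge0 yp) ?ltW//.
have := lebesgue_measure_itv `]a, b[; rewrite /= => ->.
by case: ifP => _; rewrite ?mule0 -?EFinB -?EFinM ltry.
Qed.

(** Near 0 the function [p] lies below the line of slope [p 1]. *)
Lemma modular_small_le (u : R -> R) (e t : R) :
  measurable_fun [set: completedR R] u ->
  0 <= e -> 2 * e <= 1 -> 0 < t ->
  (forall x, `|u x| <= e * \1_(`]- t, t[%classic : set R) x) ->
  (modular p 2 u <= (4 * e * p 1 * t)%:E)%E.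
Proof.
move=> mu e0 e1 t0 ue; have [p0 ph psc] := yp.
have k0 : 0 <= 2 * e * p 1 by rewrite !mulr_ge0// (young_real_ge0 yp).
have -> : (4 * e * p 1 * t)%:E =
    (\int[cm]_x ((2 * e * p 1) * \1_(`]- t, t[%classic : set R) x)%:E)%E.
  rewrite integral_scaled_indic_itv//.
  have := lebesgue_measure_itv `](- t), t[; rewrite /= => ->.
  by rewrite lte_fin gtrN// -EFinB -EFinM; congr EFin; ring.
have m1 : measurable_fun [set: completedR R]
    (fun x => (2 * e * p 1 * \1_(`]- t, t[%classic : set R) x)%:E).
  apply/measurable_EFinP; apply: measurable_funM; first exact: measurable_cst.
  by apply: measurable_caratheodory; exact: measurable_indic.
apply: (ge0_le_integral cm measurableT _ (measurable_young_abs yp 2 mu) m1).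
  by move=> x _; rewrite lee_fin; apply: (young_real_ge0 yp); exact: mulr_ge0.
move=> x _; rewrite lee_fin.
have {ue} := ue x; rewrite indicE; case: (_ \in _) => /=; rewrite ?mulr1 ?mulr0 => ue.
  apply: (@le_trans _ _ (p (2 * e * 1)));
    first by apply: ph; rewrite mulr1 ler_wpM2l.
  by apply: psc => //; rewrite e1 mulr_ge0.
by move: ue; rewrite normr_le0 => /eqP ->; rewrite normr0 mulr0 p0.
Qed.

Lemma approximable_indic_itv (a b : R) :
  approximable (\1_(`]a, b[%classic) : R -> R).
Proof.
have mI : measurable_fun [set: completedR R] (\1_(`]a, b[%classic) : R -> R).
  by apply: measurable_caratheodory; exact: measurable_indic.
apply: (@approximable_dominated_limit _ p yp (plateau a b) _ (\1_(`]a, b[%classic))).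
- move=> n; apply: (approximable_test_function yp); exact: test_function_plateau.
- exact: mI.
- exact: mI.
- by move=> c c0; exact: modular_indic_itv.
- move=> n x; have /andP[q0 q1] := plateau_itv a b n x; rewrite ger0_norm// indicE.
  have [xab|xab] := boolP (x \in (`]a, b[ : set R)%classic) => //.
  rewrite plateau_eq0//; move: xab; apply: contra => xab.
  by rewrite inE/= in_itv.
- by move=> x; exact: cvg_plateau.
Qed.

(** The sets concerned form a Dynkin system containing the rays [(x, +oo)], which
    are stable under intersection. *)
Lemma approximable_indic_borel (M : R) (S : set R) : measurable S ->
  approximable (fun x => \1_S x * \1_(`]- M, M[%classic) x).
Proof.
have aI := approximable_indic_itv (- M) M.
have mIM : measurable_fun [set: completedR R] (\1_(`]- M, M[%classic) : R -> R).
  by case: aI.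
have EG : @measurable _ R = <<s @RGenOInfty.G R >> := RGenOInfty.measurableE R.
move=> mS; have : <<s @RGenOInfty.G R >> S by rewrite -EG.
move: S {mS}; apply: (@dynkin_induction _ R (@RGenOInfty.G R)
  (fun S => approximable (fun x => \1_S x * \1_(`]- M, M[%classic) x))).
- exact: EG.
- move=> _ _ [x ->] [y ->]; exists (Num.max x y).
  by apply/seteqP; split => z /=; rewrite !in_itv/= !andbT gt_max => /andP.
- move: aI; congr approximable; apply/funext => x.
  by rewrite [X in _ = X * _]indicE in_setT mul1r.
- move=> _ [x ->]; have := approximable_indic_itv (Num.max x (- M)) M.
  congr approximable; apply/funext => y; rewrite !indicE !mem_setE !in_itv/=.
  by rewrite andbT gt_max; case: (x < y); rewrite /= ?mul1r ?mul0r.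
- move=> S mS aS; have := approximableB yp aI aS.
  congr approximable; apply/funext => x.
  by rewrite !indicE in_setC; case: (x \in S) => /=; rewrite ?mul1r ?mul0r ?subr0 ?subrr.
move=> F mF tF aF.
have sumF x n : \sum_(i < n) (\1_(F i) x : R) =
    if pselect (exists2 k, (k < n)%N & F k x) then 1 else 0.
  case: (pselect _) => [[k kn Fk]|nF]; last first.
    rewrite big1// => i _; rewrite indicE memNset// => Fi.
    by apply: nF; exists i.
  rewrite (bigD1 (Ordinal kn))//= indicE mem_set// big1 ?addr0// => i ik.
  rewrite indicE memNset// => Fi; move: ik => /eqP; apply; apply/val_inj => /=.
  by apply: (tF i k) => //; exists x.
apply: (@approximable_dominated_limit _ p yp
  (fun n x => \sum_(i < n) (\1_(F i) x * \1_(`]- M, M[%classic) x))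
  _ (\1_(`]- M, M[%classic))).
- by move=> n; exact: (approximable_sum yp).
- apply: measurable_funM; last exact: mIM.
  apply: measurable_caratheodory.
  by apply: measurable_indic; exact: bigcupT_measurable.
- exact: mIM.
- by move=> c c0; exact: modular_indic_itv.
- move=> n x; rewrite -mulr_suml normrM sumF [leRHS]indicE [\1_ _ _]indicE.
  by case: (pselect _) => ? /=; case: (_ \in _); rewrite ?normr1 ?normr0 ?mulr1 ?mulr0.
- move=> x; under eq_fun do rewrite -mulr_suml sumF.
  apply: cvgMl; apply: cvg_near_cst.
  rewrite indicE; have [|xF] := boolP (x \in \bigcup_k F k).
    rewrite inE => -[k _ Fk]; exists k.+1 => // n /= kn.
    by case: (pselect _) => // nF; exfalso; apply: nF; exists k.
  exists 0 => // n _; case: (pselect _) => //= kF; exfalso; have [k _ Fk] := kF.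
  by move/negP: xF; apply; rewrite inE; exists k.
Qed.

(** Lebesgue sets are Borel up to a null set. *)
Lemma approximable_indic (M : R) (E : set R) :
  measurable (E : set (completedR R)) ->
  approximable (fun x => \1_E x * \1_(`]- M, M[%classic) x).
Proof.
move=> mE; have : (completed_algebra_gen (@lebesgue_measure R)).-sigma.-measurable E.
  by rewrite completed_caratheodory_measurable.
rewrite g_sigma_completed_algebra_genE => -[X mX [N [A [mA A0 NA]] XNE]].
apply: (approximable_ae yp _ (approximable_indic_borel M mX)).
  apply: measurable_funM; first exact: measurable_indic_completed.
  by case: (approximable_indic_itv (- M) M).
exists A; split.
- exact: sub_caratheodory.
- exact: A0.
- move=> x /= nx; apply: NA; apply: contrapT => Nx; apply: nx => _.
  congr (_ * _); rewrite !indicE -XNE in_setU [x \in N]memNset ?orbF//.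
Qed.

(** Simple functions cut off to growing intervals converge to [f] from below. *)
Lemma approximable_ge0 f :
  measurable_fun [set: completedR R] f -> (forall x, 0 <= f x) ->
  (forall c, 0 < c -> (modular p c f < +oo)%E) -> approximable f.
Proof.
move=> mf f0 pf.
have mEf : measurable_fun [set: completedR R] (EFin \o f) by exact/measurable_EFinP.
pose s n := nnsfun_approx measurableT mEf n.
pose J n : set R := (`]- n.+1%:R, n.+1%:R[)%classic.
pose g n (x : R) : R := s n x * \1_(J n) x.
have s0 n x : 0 <= s n x by exact: fun_ge0.
have sf n x : s n x <= f x.
  by rewrite -lee_fin /s nnsfun_approxE; apply: le_approx => // y _; rewrite lee_fin.
have ag n : approximable (g n).
  have fin : finite_set (range (s n)) by exact: fimfunP.
  have -> : g n = (fun x => \sum_(y <- finmap.enum_fset (fset_set (range (s n))))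
      y * (\1_(s n @^-1` [set y]) x * \1_(J n) x)).
    apply/funext => x; rewrite /g (fimfunE (s n) x) fsbig_finite// mulr_suml.
    by apply: eq_bigr => y _; rewrite mulrA.
  apply: (approximable_sum yp) => y; apply: (approximableZ yp).
  apply: approximable_indic.
  by have := measurable_funPTI (s n) (measurable_set1 y).
have gF n x : `|g n x| <= f x.
  rewrite /g ger0_norm; last by rewrite mulr_ge0// indicE.
  by apply: le_trans (sf n x); rewrite ler_piMr// indicE lern1 leq_b1.
have gf x : g n x @[n --> \oo] --> f x.
  rewrite -[X in _ --> X]mulr1; apply: cvgM.
    have /fine_cvgP[_] := @cvg_nnsfun_approx _ _ _ _ measurableT _ mEf
      (fun y _ => f0 y) x I.
    by [].
  apply: cvg_near_cst; near=> n; rewrite indicE mem_set// /J/= in_itv/= -ltr_norml.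
  rewrite (@le_lt_trans _ _ n%:R) ?ltr_nat//.
  by near: n; exact: nbhs_infty_ger.
exact: (approximable_dominated_limit yp ag mf mf pf gF gf).
Unshelve. all: by end_near. Qed.

Theorem approximable_orlicz f : measurable_fun [set: completedR R] f ->
  (forall c, 0 < c -> (modular p c f < +oo)%E) -> approximable f.
Proof.
move=> mf pf.
have m0 : measurable_fun [set: completedR R] (fun=> 0 : R) by exact: measurable_cst.
have mp : measurable_fun [set: completedR R] (fun x => Num.max (f x) 0).
  exact: measurable_maxr.
have mNf : measurable_fun [set: completedR R] (fun x => - f x).
  exact: measurableT_comp (@oppr_measurable R setT) mf.
have mn : measurable_fun [set: completedR R] (fun x => Num.max (- f x) 0).
  exact: measurable_maxr.
have fE : f = (fun x => Num.max (f x) 0 - Num.max (- f x) 0).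
  apply/funext => x; have [f0|f0] := leP 0 (f x).
    by rewrite max_r ?oppr_le0// subr0.
  by rewrite max_l ?oppr_ge0 ?ltW// opprK add0r.
have le c (u : R -> R) : 0 < c -> measurable_fun [set: completedR R] u ->
    (forall x, `|u x| <= `|f x|) -> (modular p c u < +oo)%E.
  move=> c0 mu uf; apply: le_lt_trans (pf _ c0).
  apply: (modular_le yp mu mf (ltW c0)) => x.
  by apply: ler_wpM2l; [exact: ltW|exact: uf].
rewrite fE; apply: (approximableB yp); apply: approximable_ge0 => //.
- by move=> x; rewrite le_max lexx orbT.
- move=> c c0; apply: le => // x; have [f0|f0] := leP 0 (f x) => //.
  by rewrite normr0.
- by move=> x; rewrite le_max lexx orbT.
- move=> c c0; apply: le => // x; have [f0|f0] := leP 0 (- f x).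
    by rewrite normrN.
  by rewrite normr0.
Qed.

End density.

(** * The growing interval and the conclusion *)

Section growth.
Context {R : realType}.

(** In this form the growth condition on [T_n] no longer involves real powers. *)
Lemma expr17_le_sqrt (t : R) (n : nat) : 0 <= t -> t <= n%:R `^ (34^-1) ->
  t ^+ 17 <= Num.sqrt n%:R.
Proof.
move=> t0 tn; rewrite -(ler_pXn2r (n := 2))// ?nnegrE ?exprn_ge0 ?sqrtr_ge0//.
rewrite sqr_sqrtr// -exprM; apply: (@le_trans _ _ ((n%:R `^ 34^-1) ^+ 34)).
  by rewrite lerXn2r ?nnegrE ?powR_ge0.
by rewrite -powR_mulrn ?powR_ge0// -powRrM mulVf ?pnatr_eq0// powRr1.
Qed.

(** Seven powers of [t] from the weight against seventeen from [sqrt n]. *)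
Lemma hermite_error_le (K t x : R) (n : nat) : 0 <= K -> 1 <= t -> `|x| <= t ->
  t <= n%:R `^ (34^-1) ->
  K * (1 + `|x|) ^+ 7 / Num.sqrt n%:R <= 128 * K / t ^+ 2.
Proof.
move=> K0 t1 xt tn; have t0 : 0 < t by exact: lt_le_trans t1.
have s17 := expr17_le_sqrt (ltW t0) tn.
have s0 : 0 < Num.sqrt (n%:R : R) by apply: lt_le_trans s17; rewrite exprn_gt0.
rewrite ler_pdivrMr// mulrAC ler_pdivlMr ?exprn_gt0//.
have x7 : (1 + `|x|) ^+ 7 <= 128 * t ^+ 7.
  rewrite (_ : 128 * t ^+ 7 = (2 * t) ^+ 7); last by rewrite exprMn; congr (_ * _); ring.
  by rewrite lerXn2r ?nnegrE ?addr_ge0 ?mulr_ge0 ?(ltW t0)//; lra.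
apply: (@le_trans _ _ (K * (128 * t ^+ 7) * t ^+ 2)).
  by rewrite ler_wpM2r ?exprn_ge0 ?(ltW t0)// ler_wpM2l.
have -> : K * (128 * t ^+ 7) * t ^+ 2 = 128 * K * t ^+ 9 by ring.
rewrite ler_wpM2l ?mulr_ge0// (le_trans _ s17)//.
by rewrite ler_weXn2l.
Qed.

Lemma continuous_hermite_sum n (f : R -> R) : continuous (hermite_sum n f).
Proof.
rewrite /hermite_sum; elim: n => [|n IH].
  rewrite (_ : (fun x => _) = (fun x => hermite_coef f 0 * hermite_fun 0 x)).
    by move=> x; apply: cvgMr; exact: continuous_hermite.
  by apply/funext => x; rewrite big_ord_recl big_ord0 addr0.
rewrite (_ : (fun x => _) = (fun x => \sum_(k < n.+1) hermite_coef f k * hermite_fun k x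
    + hermite_coef f n.+1 * hermite_fun n.+1 x)).
  move=> x; apply: cvgD; first exact: IH.
  by apply: cvgMr; exact: continuous_hermite.
by apply/funext => x; rewrite big_ord_recr.
Qed.

End growth.

Theorem corollary1p7 (R : realType) (A B : R -> \bar R)
  (youngA : young_function A) (youngB : young_function B)
  (domBA : exists2 c : R, 0 < c & forall t : R, 0 < t -> (B t <= A (c * t)%R)%E)
  (finA : forall t : R, 0 <= t -> (A t < +oo)%E)
  (logB : exists2 kappa : R, 0 < kappa &
    (\int[completed_lebesgue_measure]_(t in `]0%R, +oo[)
       B (kappa * ln (1 + t^-1))%R < +oo)%E)
  (intAB : exists2 K : R, 0 < K & forall t : R, 0 < t ->
    (\int[completed_lebesgue_measure]_(s in `]0%R, t[) (B s * ((s ^+ 2)^-1)%:E)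
       <= A (K * t)%R * (t^-1)%:E)%E /\
    (\int[completed_lebesgue_measure]_(s in `]0%R, t[)
         (conjugate A s * ((s ^+ 2)^-1)%:E)
       <= conjugate B (K * t)%R * (t^-1)%:E)%E)
  (T : nat -> R)
  (T_gt0 : forall n : nat, (1 <= n)%N -> 0 < T n)
  (T_ndecr : forall m n : nat, (1 <= m)%N -> (m <= n)%N -> T m <= T n)
  (T_cvg : T n @[n --> \oo] --> +oo)
  (T_o : T =o_\oo (fun n : nat => n%:R `^ (34^-1)))
  (f : R -> R) (fE : orlicz_E A f)
  (eps : R) (eps_gt0 : 0 < eps) :
  exists (h : R -> R) (n0 : nat),
    [/\ smooth h, compactly_supported h &
        forall n : nat, (n0 <= n)%N -> (1 <= n)%N ->
          (\int[completed_lebesgue_measure]_x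
             B `|\1_(`]- T n, T n[) x * hermite_sum n h x - f x|%R < eps%:E)%E].
Proof.
have [a ya aE] := young_realP youngA finA.
have [c c0 BA] := domBA.
have finB (t : R) : 0 <= t -> (B t < +oo)%E.
  rewrite le_eqVlt => /predU1P[<-|t0]; first by case: youngB => -> _ _ _ _; exact: ltry.
  by apply: le_lt_trans (BA _ t0) _; apply: finA; rewrite mulr_ge0// ltW.
have [b yb bE] := young_realP youngB finB.
have ba (t : R) : 0 <= t -> b t <= a (c * t).
  rewrite le_eqVlt => /predU1P[<-|t0].
    by rewrite mulr0; case: ya => -> _ _; case: yb => -> _ _.
  by have := BA _ t0; rewrite bE ?aE ?mulr_ge0 ?(ltW c0) ?(ltW t0)// lee_fin.
have [mf Af] := fE.
have af : approximable a f.
  apply: approximable_orlicz => // d d0; apply: le_lt_trans (Af _ d0).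
  rewrite /modular; under [leRHS]eq_integral => x _.
    rewrite aE ?mulr_ge0 ?(ltW d0)//. over.
  exact: lexx.
have e2 : 0 < eps / 2 by rewrite divr_gt0.
have c2 : 0 < 2 * c by rewrite mulr_gt0.
have [h th hf] := af.2 _ _ c2 e2.
have sh := test_function_smooth th; have ch := test_function_compactly_supported th.
have mh := measurable_test_function th.
have [K K0 hK] := hermite_sum_uniform sh ch.
have [_ [M hM]] := th.
pose b1 := b 1; have b10 : 0 <= b1 by exact: (young_real_ge0 yb).
have [C C_ge0 CK] : exists2 C, 0 <= C & C = 128 * K.
  by exists (128 * K) => //; apply: mulr_ge0.
(* beyond [L]: [T_n] exceeds 1 and the support of [h], the error is at most 1/2,
   and its integral is less than [eps / 2] *)
pose L := 1 + `|M| + 2 * C + 8 * C * b1 / eps.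
have L0 : 0 <= 8 * C * b1 / eps by rewrite divr_ge0 ?(ltW eps_gt0)// !mulr_ge0.
have [N1 _ TL] : \forall n \near \oo, L + 1 <= T n.
  by move: T_cvg => /cvgryPge; apply.
have [N2 _ To] : \forall n \near \oo, `|T n| <= 1 * `|(n%:R : R) `^ (34^-1)|.
  by move: T_o => /eqoP/(_ 1 ltr01).
exists h, (maxn 2 (maxn N1 N2)); split => // n; rewrite !geq_max => /and3P[n2 n1 n3] _.
have Tn := TL n n1; have Tn34 := To n n3.
rewrite mul1r (ger0_norm (powR_ge0 _ _)) in Tn34.
set t := T n in Tn Tn34 *.
have C2 : 0 <= 2 * C by rewrite mulr_ge0.
have M0 : 0 <= `|M| by [].
have t1 : 1 <= t by apply: le_trans Tn; rewrite /L; lra.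
have t0 : 0 < t by exact: lt_le_trans t1.
have tM : M < t.
  apply: lt_le_trans Tn; have := ler_norm M; rewrite /L; lra.
have tK : 2 * C <= t by apply: le_trans Tn; rewrite /L; lra.
have tb : 8 * C * b1 / eps < t.
  by apply: lt_le_trans Tn; rewrite /L; lra.
rewrite (ger0_norm (ltW t0)) in Tn34.
have mI : measurable_fun [set: completedR R] (\1_(`]- t, t[%classic) : R -> R).
  by apply: measurable_caratheodory; exact: measurable_indic.
have mS : measurable_fun [set: completedR R] (hermite_sum n h).
  by apply: measurable_caratheodory; apply: continuous_measurable_fun; exact: continuous_hermite_sum.
pose u (x : R) := \1_(`]- t, t[%classic) x * hermite_sum n h x - h x.
pose D (x : R) := \1_(`]- t, t[%classic) x * hermite_sum n h x - f x.
have mIS : measurable_fun [set: completedR R]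
    (fun x => \1_(`]- t, t[%classic) x * hermite_sum n h x).
  exact: measurable_funM mI mS.
have mu : measurable_fun [set: completedR R] u by exact: measurable_funB mIS mh.
have mD : measurable_fun [set: completedR R] D by exact: measurable_funB mIS mf.
have mhf : measurable_fun [set: completedR R] (fun x => h x - f x).
  by exact: measurable_funB mh mf.
have mfh : measurable_fun [set: completedR R] (fun x => f x - h x).
  by exact: measurable_funB mf mh.
have -> : (\int[completed_lebesgue_measure]_x B `|D x|%R = modular b 1 D)%E.
  by apply: eq_integral => x _; rewrite bE// mul1r.
(* [chi_n S_n h - f] is split at [h] *)
have split1 : (modular b 1 D <= modular b 2 u + modular b 2 (fun x => h x - f x)%R)%E.
  have := @modular_le_add _ b yb 1 1 1 D u (fun x => h x - f x)
    mD mu mhf ler01 ler01 ler01.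
  rewrite !mulr1; apply => x; rewrite !mul1r.
  have -> : D x = u x + (h x - f x) by rewrite /D /u addrA subrK.
  exact: ler_normD.
apply: le_lt_trans split1 _.
have p2 : (modular b 2 (fun x => h x - f x)%R < (eps / 2)%:E)%E.
  apply: le_lt_trans hf; rewrite /modular.
  apply: (ge0_le_integral completed_lebesgue_measure measurableT _
    (measurable_young_abs yb 2 mhf) (measurable_young_abs ya (2 * c) mfh)).
    by move=> x _; rewrite lee_fin; apply: (young_real_ge0 yb); exact: mulr_ge0.
  move=> x _; rewrite lee_fin distrC; apply: le_trans (ba _ _) _; first exact: mulr_ge0.
  by rewrite mulrCA mulrA.
pose e := C / t ^+ 2.
have e0 : 0 <= e by rewrite divr_ge0// exprn_ge0// ltW.
have et : e * t <= C / t.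
  by rewrite /e expr2 invfM mulrA divfK// gt_eqF.
have p1 : (modular b 2 u <= (4 * e * b1 * t)%:E)%E.
  apply: (modular_small_le yb mu e0 _ t0).
    rewrite /e mulrA ler_pdivrMr ?exprn_gt0// mul1r.
    rewrite (@le_trans _ _ t)//.
    by rewrite expr2 ler_peMl// ltW.
  move=> x; rewrite /u indicE; have [|xt] := boolP (x \in _); last first.
    rewrite mul0r mulr0 sub0r normrN hM ?normr0//.
    move: xt; rewrite notin_setE/= in_itv/= -ltr_norml => /negP; rewrite -leNgt.
    exact: lt_le_trans.
  rewrite inE/= in_itv/= -ltr_norml => xt; rewrite mul1r mulr1.
  have [k nk] : exists k, n = k.+2 by case: (n) n2 => [|[|k]]// _; exists k.
  have xn : x ^+ 2 <= k.+2%:R.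
    rewrite -nk -(real_normK (num_real x)) -[leRHS](@sqr_sqrtr _ n%:R)//.
    rewrite lerXn2r ?nnegrE ?sqrtr_ge0//.
    apply: le_trans (expr17_le_sqrt (ltW t0) Tn34).
    by rewrite (le_trans (ltW xt))// -[leLHS]expr1 ler_weXn2l.
  rewrite nk; apply: le_trans (hK k x xn) _.
  by rewrite /e CK -nk; exact: hermite_error_le (ltW xt) Tn34.
have p1' : 4 * e * b1 * t < eps / 2.
  apply: (@le_lt_trans _ _ (4 * b1 * (C / t))).
    rewrite (_ : 4 * e * b1 * t = 4 * b1 * (e * t)); last by ring.
    by rewrite ler_wpM2l ?mulr_ge0.
  rewrite mulrA ltr_pdivrMr// mulrC mulrAC.
  move: tb; rewrite ltr_pdivrMr// => tb.
  by rewrite ltr_pdivlMr//; move: tb; lra.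
rewrite (splitr eps) EFinD; apply: lteD p2.
by apply: le_lt_trans p1 _; rewrite lte_fin.
Qed.
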